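(* Let $\Bbbk$ be a finite field of characteristic $p>0$ with $q=p^a$ elements and algebraic closure $\overline{\Bbbk}$. There exists a continuous $W(\Bbbk)$-linear mapping $\bar\tau:W(\overline{\Bbbk})\to W(\overline{\Bbbk})$ such that (1) $\bar\tau^2=I$; (2) $\bar\tau\pi=\pi^{-1}\bar\tau$; (3) for any finite extension $E/\Bbbk$ (inside $\overline{\Bbbk}$), $\bar\tau$ preserves $W(E)\subset W(\overline{\Bbbk})$; (4) for any finite extensions $L\supset E\supset\Bbbk$, $\bar\tau$ commutes with the trace, i.e. $\mathrm{Trace}_{L/E}\circ(\bar\tau|W(L))=(\bar\tau|W(E))\circ\mathrm{Trace}_{L/E}$, and with the inclusion $W(E)\subset W(L)$, i.e. $(\bar\tau|W(L))|W(E)=\bar\tau|W(E)$.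
   Context: $W(\cdot)$ denotes the ring of (infinite $p$-typical) Witt vectors, with its $p$-adic topology. $\pi:W(\overline{\Bbbk})\to W(\overline{\Bbbk})$ is the unique lift of the Frobenius $x\mapsto x^q$ of $\overline{\Bbbk}$. $\mathrm{Trace}_{L/E}:W(L)\to W(E)$ is the trace for the unramified extension of fraction fields, whose Galois group is identified with $\mathrm{Gal}(L/E)$. *)

(* Defs.v *)
From HB Require Import structures.
From mathcomp Require Import all_boot all_order all_algebra all_fingroup all_field.
From mathcomp Require Import finmap boolp ring.
From mathcomp.multinomials Require Import monalg.

Set Implicit Arguments.
Unset Strict Implicit.
Unset Printing Implicit Defensive.

Import GRing.Theory.
Local Open Scope ring_scope.

Section Cong.
Variables (p : nat) (R : comNzRingType).
Implicit Types (a b c d : R) (m n : nat).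

Definition cong n a b := exists c, a = b + (p ^ n)%:R * c.

Lemma cong_refl n a : cong n a a.
Proof. by exists 0; rewrite mulr0 addr0. Qed.

Lemma cong_sym n a b : cong n a b -> cong n b a.
Proof. by case=> c ->; exists (- c); rewrite mulrN addrK. Qed.

Lemma cong_trans n a b c : cong n a b -> cong n b c -> cong n a c.
Proof. by case=> x -> [y ->]; exists (y + x); rewrite mulrDr addrA. Qed.

Lemma congD n a b c d : cong n a b -> cong n c d -> cong n (a + c) (b + d).
Proof. by case=> x -> [y ->]; exists (x + y); rewrite mulrDr addrACA. Qed.

Lemma congN n a b : cong n a b -> cong n (- a) (- b).
Proof. by case=> x ->; exists (- x); rewrite mulrN opprD. Qed.

Lemma congM n a b c d : cong n a b -> cong n c d -> cong n (a * c) (b * d).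
Proof.
by case=> x -> [y ->]; exists (b * y + x * (d + (p ^ n)%:R * y)); ring.
Qed.

Lemma congX n a b k : cong n a b -> cong n (a ^+ k) (b ^+ k).
Proof.
move=> ab; elim: k => [|k IH]; first exact: cong_refl.
by rewrite !exprS; apply: congM.
Qed.

Lemma cong_sum n (I : Type) (r : seq I) (P : pred I) (F G : I -> R) :
  (forall i, P i -> cong n (F i) (G i)) ->
  cong n (\sum_(i <- r | P i) F i) (\sum_(i <- r | P i) G i).
Proof.
by move=> FG; elim/big_rec2: _ => [|i x y Pi xy];
  [apply: cong_refl | apply: congD; first exact: FG].
Qed.

Lemma cong_scale m n a b :
  cong n a b -> cong (m + n) ((p ^ m)%:R * a) ((p ^ m)%:R * b).
Proof. by case=> c ->; exists c; rewrite mulrDr expnD natrM mulrA. Qed.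

End Cong.

Section CongPrime.
Variables (p : nat) (R : comNzRingType) (p_pr : prime p).
Implicit Types (a b c : R).

Lemma cong_exprDp a b : cong p 1 ((a + b) ^+ p) (a ^+ p + b ^+ p).
Proof.
have [m Ep] : exists m, p = m.+1 by exists p.-1; rewrite prednK ?prime_gt0.
have cs0 : forall (r : seq 'I_m) (F : 'I_m -> R), (forall i, cong p 1 (F i) 0) ->
  cong p 1 (\sum_(i <- r) F i) 0.
  move=> r F F0; elim/big_rec: _ => [|i x _ x0]; first exact: cong_refl.
  by rewrite -[X in cong _ _ _ X](addr0 (0 : R)); apply: congD.
have pC i : (i < m)%N -> (p %| 'C(p, i.+1))%N.
  by move=> im; rewrite prime_dvd_bin // Ep; apply: im.
rewrite exprDn {}Ep in pC cs0 *; rewrite big_ord_recl big_ord_recr /= subn0 !expr0 mulr1.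
rewrite /bump /= add1n subnn expr0 mul1r bin0 binn !mulr1n.
apply: congD; first exact: cong_refl.
rewrite -[X in cong _ _ _ X]add0r; apply: congD; last exact: cong_refl.
apply: cs0 => i; have /dvdnP[k ->] := pC _ (ltn_ord i).
exists ((a ^+ (m.+1 - (1 + i)) * b ^+ (1 + i)) *+ k).
by rewrite expn1 add0r mulrnA mulr_natl.
Qed.

Lemma cong_expp n a b : cong p n.+1 a b -> cong p n.+2 (a ^+ p) (b ^+ p).
Proof.
case=> c Ea.
have ab : cong p 1 a b by exists ((p ^ n)%:R * c); rewrite mulrA -natrM -expnD add1n.
have [d Ed] : cong p 1 (\sum_(i < p) a ^+ (p.-1 - i) * b ^+ i) 0.
  apply: (@cong_trans p R _ _ (\sum_(i < p) b ^+ p.-1)); last first.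
    exists (b ^+ p.-1); rewrite add0r expn1 sumr_const card_ord.
    by rewrite mulr_natl.
  apply: cong_sum => i _.
  have le : (i <= p.-1)%N by rewrite -ltnS prednK ?prime_gt0.
  rewrite -{2}(subnK le) exprD; apply: congM; last exact: cong_refl.
  exact: congX.
exists (c * d); apply/eqP; rewrite addrC -subr_eq; apply/eqP.
have -> : a ^+ p - b ^+ p = (a - b) * \sum_(i < p) a ^+ (p.-1 - i) * b ^+ i.
  by rewrite subrXX.
by rewrite Ed add0r Ea [b + _]addrC addrK mulrACA -natrM -expnD addn1.
Qed.

Lemma cong_exppX n m a b : cong p n.+1 a b ->
  cong p (m + n.+1) (a ^+ (p ^ m)) (b ^+ (p ^ m)).
Proof.
move=> ab; elim: m => [|m IH]; first by rewrite !expr1.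
rewrite expnSr !exprM addSn.
by move: IH; rewrite addnS => /cong_expp.
Qed.

End CongPrime.

(* Integral polynomials in the variables X_(j, i), (j, i) in nat * nat; X_(j, i)
   stands for the i-th component of the j-th Witt vector in play. *)
Notation zpoly := {malg int[{cmonom (nat * nat)%type}]}.

Definition zvar (v : nat * nat) : zpoly := << ucm v >>.

Section Eval.
Variables (R : comNzRingType) (v : nat * nat -> R).

Definition mon_eval (m : {cmonom (nat * nat)%type}) : R :=
  \prod_(i <- finsupp m) v i ^+ m i.

Lemma mon_evalw (d : {fset (nat * nat)}) (m : {cmonom (nat * nat)%type}) :
  (finsupp m `<=` d)%fset -> mon_eval m = \prod_(i <- d) v i ^+ m i.
Proof.
move=> le; rewrite /mon_eval; apply: big_fset_incl => // i _.
by rewrite -cmE_eq0 => /eqP->; rewrite expr0.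
Qed.

Lemma mon_evalM : mmorphism mon_eval.
Proof.
split=> [m1 m2|]; last by rewrite /mon_eval mdom1 big_nil.
rewrite (@mon_evalw (finsupp m1 `|` finsupp m2)%fset) ?mdomD //.
rewrite (@mon_evalw (finsupp m1 `|` finsupp m2)%fset m1) ?fsubsetUl //.
rewrite (@mon_evalw (finsupp m1 `|` finsupp m2)%fset m2) ?fsubsetUr //.
by rewrite -big_split /=; apply: eq_bigr => i _; rewrite cmM exprD.
Qed.

HB.instance Definition _ :=
  isMultiplicative.Build {cmonom (nat * nat)%type} R mon_eval mon_evalM.

Definition zeval : zpoly -> R := mmap intr mon_eval.

HB.instance Definition _ := GRing.RMorphism.on zeval.

Lemma zeval_var i : zeval (zvar i) = v i.
Proof.
by rewrite /zeval /zvar mmapU /= mul1r /mon_eval mdomU big_seq_fset1 cmUU expr1.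
Qed.

End Eval.

Lemma zeval_comp (R S : comNzRingType) (f : {rmorphism R -> S})
    (v : nat * nat -> R) a : f (zeval v a) = zeval (f \o v) a.
Proof.
rewrite /zeval /mmap rmorph_sum /=; apply: eq_bigr => m _.
rewrite rmorphM rmorph_int /mon_eval rmorph_prod; congr (_ * _).
by apply: eq_bigr => i _; rewrite rmorphXn.
Qed.

Lemma eq_zeval (R : comNzRingType) (v w : nat * nat -> R) :
  v =1 w -> zeval v =1 zeval w.
Proof.
move=> vw a; rewrite /zeval /mmap; apply: eq_bigr => m _; congr (_ * _).
by rewrite /mon_eval; apply: eq_bigr => i _; rewrite vw.
Qed.

Lemma zmonM (k1 k2 : {cmonom (nat * nat)%type}) :
  << k1 >> * << k2 >> = << mulcm k1 k2 >> :> zpoly.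
Proof. by rewrite malgM_def fgmulUU mul1r. Qed.

Lemma zpoly_ind (P : zpoly -> Prop) :
  P 1 -> (forall v, P (zvar v)) -> (forall a, P a -> P (- a)) ->
  (forall a b, P a -> P b -> P (a + b)) ->
  (forall a b, P a -> P b -> P (a * b)) -> forall a, P a.
Proof.
move=> P1 Pv PN PD PM.
have P0 : P 0 by rewrite -(subrr (1 : zpoly)); apply: PD => //; apply: PN.
have PX a n : P a -> P (a ^+ n).
  by move=> Pa; elim: n => [|n IH]; rewrite ?expr0 ?exprS //; apply: PM.
have Pn n : P n%:R by elim: n => [|n IH] //; rewrite -addn1 natrD; apply: PD.
have Pm (m : {cmonom (nat * nat)%type}) : P (<< m >> : zpoly).
  have -> : << m >> = \prod_(i <- finsupp m) zvar i ^+ m i :> zpoly.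
    have mX i n : zvar i ^+ n = << expcmn (ucm i) n >> :> zpoly.
      elim: n => [|n IH]; first by [].
      rewrite exprS IH /zvar.
      have -> : expcmn (ucm i) n.+1 = mulcm (ucm i) (expcmn (ucm i) n).
        rewrite /expcmn; case: n {IH} => [|n]; last by [].
        by rewrite /= mulcm0.
      exact: zmonM.
    have prodU (r : seq (nat * nat)) (F : nat * nat -> {cmonom (nat * nat)%type}) :
        \prod_(i <- r) << F i >> = << \big[(@mulcm _)/onecm _]_(i <- r) F i >> :> zpoly.
      apply/esym/(big_morph (fun m : {cmonom (nat * nat)%type} => << m >> : zpoly)).
        by move=> k1 k2; rewrite zmonM.
      by [].
    under eq_bigr do rewrite mX.
    rewrite prodU; congr (<< _ >>); apply/eqP/cmP => j.
    have exE i n : expcmn (ucm i) n j = ((i == j) * n)%N.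
      elim: n => [|n IH]; first by rewrite onecmE muln0.
      have -> : expcmn (ucm i) n.+1 = mulcm (ucm i) (expcmn (ucm i) n).
        rewrite /expcmn; case: n {IH} => [|n]; last by [].
        by rewrite /= mulcm0.
      by rewrite mulcmE IH ucmE mulnS.
    have -> : (\big[(@mulcm _)/onecm _]_(i <- finsupp m) expcmn (ucm i) (m i)) j
        = (\sum_(i <- finsupp m) (i == j) * m i)%N.
      elim: (enum_fset (finsupp m)) => [|i r IH]; first by rewrite !big_nil onecmE.
      by rewrite !big_cons mulcmE IH exE.
    have [jm|jm] := boolP (j \in finsupp m).
      rewrite (big_fsetD1 j) //= eqxx mul1n big1_seq ?addn0 // => i.
      by rewrite !inE => /andP[_ /andP[/negPf-> _]].
    rewrite (eqP (_ : m j == 0%N)) ?cmE_eq0 // big1_seq // => i /andP[_ im].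
    by case: eqP im jm => [<- ->|].
  elim/big_rec: _ => [|i x _ Px]; first exact: P1.
  by apply: PM; [apply: PX; apply: Pv | exact: Px].
have Pmn (m : {cmonom (nat * nat)%type}) n : P ((<< m >> : zpoly) *+ n).
  elim: n => [|n IH]; first by rewrite mulr0n; exact: P0.
  by rewrite mulrS; apply: PD; [exact: Pm | exact: IH].
move=> a; rewrite (monalgE a).
elim/big_rec: _ => [|m x _ Px]; first exact: P0.
apply: PD; last exact: Px.
have -> : << a@_m *g m >> = << m >> *~ a@_m :> zpoly by rewrite -raddfMz intz.
case: (a@_m) => n; [exact: (Pmn m n) | exact: (PN _ (Pmn m n.+1))].
Qed.

Lemma zpoly_natI (n : nat) (a b : zpoly) :
  (0 < n)%N -> n%:R * a = n%:R * b -> a = b.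
Proof.
move=> n0 /eqP; rewrite !mulr_natl -subr_eq0 -mulrnBl => /eqP ab0.
apply/eqP; rewrite -subr_eq0; apply/eqP/malgP => k.
have /malgP/(_ k) := ab0; rewrite mcoeffMn !mcoeff0 => /eqP.
by rewrite Num.Theory.mulrn_eq0 -leqn0 leqNgt n0 /= => /eqP.
Qed.

Section Ghost.
Variable p : nat.

(* w_n(x) = \sum_(i <= n) p^i x_i^(p^(n-i)) *)
Definition ghost (R : comNzRingType) (n : nat) (x : nat -> R) : R :=
  \sum_(i < n.+1) (p ^ i)%:R * x i ^+ (p ^ (n - i)).

Lemma ghost_map (R S : comNzRingType) (f : {rmorphism R -> S}) n x :
  f (ghost n x) = ghost n (f \o x).
Proof.
rewrite /ghost rmorph_sum /=; apply: eq_bigr => i _.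
by rewrite rmorphM rmorph_nat rmorphXn.
Qed.

Lemma eq_ghost (R : comNzRingType) n (x y : nat -> R) :
  (forall i, (i <= n)%N -> x i = y i) -> ghost n x = ghost n y.
Proof. by move=> xy; apply: eq_bigr => i _; rewrite xy // -ltnS. Qed.

Lemma ghostS (R : comNzRingType) n (x : nat -> R) : ghost n.+1 x =
  \sum_(i < n.+1) (p ^ i)%:R * x i ^+ (p ^ (n.+1 - i)) + (p ^ n.+1)%:R * x n.+1.
Proof. by rewrite /ghost big_ord_recr /= subnn expn0 expr1. Qed.

(* A is p-torsion free and phi is an endomorphism of A lifting Frobenius. *)
Section Dwork.
Variables (p_pr : prime p) (A : comNzRingType) (phi : {rmorphism A -> A}).
Hypothesis A_natI :
  forall (n : nat) (a b : A), (0 < n)%N -> n%:R * a = n%:R * b -> a = b.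

Definition ghost_cong (g : nat -> A) :=
  forall n, cong p n.+1 (g n.+1) (phi (g n)).

Lemma ghost_congD g h :
  ghost_cong g -> ghost_cong h -> ghost_cong (fun n => g n + h n).
Proof. by move=> cg ch n; rewrite rmorphD; apply: congD. Qed.

Lemma ghost_congM g h :
  ghost_cong g -> ghost_cong h -> ghost_cong (fun n => g n * h n).
Proof. by move=> cg ch n; rewrite rmorphM; apply: congM. Qed.

Lemma ghost_congN g : ghost_cong g -> ghost_cong (fun n => - g n).
Proof. by move=> cg n; rewrite rmorphN; apply: congN. Qed.

Definition frob_at a := cong p 1 (phi a) (a ^+ p).

Lemma frob_at1 : frob_at 1.
Proof. by rewrite /frob_at rmorph1 expr1n; apply: cong_refl. Qed.

Lemma frob_atN a : frob_at a -> frob_at (- a).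
Proof.
rewrite /frob_at rmorphN => IH; apply: (cong_trans (congN IH)).
have := cong_exprDp p_pr a (- a).
rewrite subrr expr0n eqn0Ngt prime_gt0 // => /(congD (cong_refl p 1 (- a ^+ p))).
by rewrite addr0 addKr.
Qed.

Lemma frob_atD a b : frob_at a -> frob_at b -> frob_at (a + b).
Proof.
rewrite /frob_at rmorphD => IHa IHb; apply: (cong_trans (congD IHa IHb)).
exact/cong_sym/cong_exprDp.
Qed.

Lemma frob_atM a b : frob_at a -> frob_at b -> frob_at (a * b).
Proof. by rewrite /frob_at rmorphM exprMn; apply: congM. Qed.

Hypothesis phi_frob : forall a, frob_at a.

Lemma phi_ghost n (x : nat -> A) : cong p n.+1 (phi (ghost n x))
  (\sum_(i < n.+1) (p ^ i)%:R * x i ^+ (p ^ (n.+1 - i))).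
Proof.
rewrite ghost_map; apply: cong_sum => i _.
have le : (i <= n)%N by rewrite -ltnS.
have En : n.+1 = (i + (n - i).+1)%N by rewrite addnS subnKC.
have := cong_exppX p_pr (n - i) (phi_frob (x i)).
rewrite -exprM -expnS -subSn // addn1 -subSn // => /(cong_scale i).
by rewrite subnKC // leqW.
Qed.

Lemma ghost_cong_ghost x : ghost_cong (fun n => ghost n x).
Proof.
move=> n; apply: cong_sym; apply: (cong_trans (phi_ghost n x)).
apply: cong_sym.
by exists (x n.+1); rewrite ghostS.
Qed.

Lemma ghost_injn N (x y : nat -> A) :
  (forall n, (n <= N)%N -> ghost n x = ghost n y) ->
  forall n, (n <= N)%N -> x n = y n.
Proof.
move=> xy n; have [m] := ubnP n; elim: m n => // m IH n; rewrite ltnS => nm nN.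
have := xy n nN; case: n nm nN => [|n] nm nN.
  by rewrite /ghost !big_ord1 subn0 expn0 !expr1 !mul1r.
rewrite !ghostS.
have -> : \sum_(i < n.+1) (p ^ i)%:R * x i ^+ (p ^ (n.+1 - i)) =
          \sum_(i < n.+1) (p ^ i)%:R * y i ^+ (p ^ (n.+1 - i)).
  apply: eq_bigr => i _; congr (_ * _ ^+ _); apply: IH.
    exact: leq_trans (ltn_ord i) nm.
  exact: leq_trans (ltnW (ltn_ord i)) nN.
by move/addrI/A_natI; apply; rewrite expn_gt0 prime_gt0.
Qed.

Lemma ghost_inj (x y : nat -> A) :
  (forall n, ghost n x = ghost n y) -> x =1 y.
Proof. by move=> xy n; apply: (@ghost_injn n). Qed.

Lemma dwork g : ghost_cong g -> exists x, forall n, ghost n x = g n.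
Proof.
move=> cg.
have /choice[X XP] : forall N, exists x, forall n, (n <= N)%N -> ghost n x = g n.
  elim=> [|N [x xP]].
    exists (fun=> g 0%N) => n; rewrite leqn0 => /eqP->.
    by rewrite /ghost big_ord1 subn0 expn0 expr1 mul1r.
  have [c Ec] : cong p N.+1 (g N.+1)
      (\sum_(i < N.+1) (p ^ i)%:R * x i ^+ (p ^ (N.+1 - i))).
    by apply: (cong_trans (cg N)); rewrite -xP //; apply: phi_ghost.
  exists (fun i => if (i <= N)%N then x i else c) => n.
  rewrite leq_eqVlt => /predU1P[->|]; last first.
    rewrite ltnS => nN; rewrite -xP //; apply: eq_ghost => i ni.
    by rewrite (leq_trans ni nN).
  rewrite ghostS ltnn Ec; congr (_ + _); apply: eq_bigr => i _.
  by rewrite -ltnS ltn_ord.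
exists (fun n => X n n) => n; rewrite -(XP n n) //; apply: eq_ghost => i ni.
apply: (@ghost_injn i) => // k ki.
by rewrite !XP // (leq_trans ki ni).
Qed.

End Dwork.

Definition zfrob : zpoly -> zpoly := zeval (fun v => zvar v ^+ p).
HB.instance Definition _ := GRing.RMorphism.on zfrob.

Hypothesis p_pr : prime p.

Lemma zfrob_cong a : frob_at zfrob a.
Proof.
apply: (zpoly_ind (P := frob_at zfrob)).
- exact: frob_at1.
- by move=> v; rewrite /frob_at [X in cong _ _ X](zeval_var _ v); exact: cong_refl.
- exact: (frob_atN p_pr).
- exact: (frob_atD p_pr).
- exact: frob_atM.
Qed.

Definition zdwork := dwork p_pr zpoly_natI zfrob_cong.
Definition zghost_cong := ghost_cong_ghost p_pr zfrob_cong.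

Definition zgen (j n : nat) : zpoly := zvar (j, n).

Lemma witt_add_exists : exists S : nat -> zpoly,
  forall n, ghost n S = ghost n (zgen 0) + ghost n (zgen 1).
Proof.
exact: (zdwork (ghost_congD (zghost_cong (zgen 0)) (zghost_cong (zgen 1)))).
Qed.

Lemma witt_mul_exists : exists P : nat -> zpoly,
  forall n, ghost n P = ghost n (zgen 0) * ghost n (zgen 1).
Proof.
exact: (zdwork (ghost_congM (zghost_cong (zgen 0)) (zghost_cong (zgen 1)))).
Qed.

Lemma witt_opp_exists : exists I : nat -> zpoly,
  forall n, ghost n I = - ghost n (zgen 0).
Proof. exact: (zdwork (ghost_congN (zghost_cong (zgen 0)))). Qed.

(* The universal Witt polynomials S_n, P_n, I_n: by [ghost_inj] and [zpoly_natI]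
   they are the only sequences with the ghost components required below. *)
Definition add_poly : nat -> zpoly := projT1 (cid witt_add_exists).
Definition mul_poly : nat -> zpoly := projT1 (cid witt_mul_exists).
Definition opp_poly : nat -> zpoly := projT1 (cid witt_opp_exists).

Lemma ghost_add_poly n :
  ghost n add_poly = ghost n (zgen 0) + ghost n (zgen 1).
Proof. exact: (projT2 (cid witt_add_exists)). Qed.

Lemma ghost_mul_poly n :
  ghost n mul_poly = ghost n (zgen 0) * ghost n (zgen 1).
Proof. exact: (projT2 (cid witt_mul_exists)). Qed.

Lemma ghost_opp_poly n : ghost n opp_poly = - ghost n (zgen 0).
Proof. exact: (projT2 (cid witt_opp_exists)). Qed.

End Ghost.

(* The p-typical Witt vectors (x_0, x_1, ...) over R. The primality proof is a
   parameter because the ring laws exist only for prime p; it is irrelevant. *)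
Definition witt (p : nat) (p_pr : prime p) (R : Type) : Type := nat -> R.

HB.instance Definition _ p (p_pr : prime p) R := gen_eqMixin (witt p_pr R).
HB.instance Definition _ p (p_pr : prime p) R := gen_choiceMixin (witt p_pr R).

Definition witt_map p (p_pr : prime p) (R S : Type) (f : R -> S)
  (x : witt p_pr R) : witt p_pr S := fun n => f (x n).

Section WittRing.
Variables (p : nat) (p_pr : prime p).

Section Ops.
Variable R : comNzRingType.
Local Notation W := (witt p_pr R).
Implicit Types x y z : W.

(* Substitutes the i-th component of the j-th vector of s for X_(j, i). *)
Definition subst (s : seq W) (v : nat * nat) : R := nth (fun=> 0) s v.1 v.2.

Definition witt_zero : W := fun=> 0.
Definition witt_one : W := fun n => (n == 0%N)%:R.
Definition witt_add x y : W := fun n => zeval (subst [:: x; y]) (add_poly p_pr n).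
Definition witt_mul x y : W := fun n => zeval (subst [:: x; y]) (mul_poly p_pr n).
Definition witt_opp x : W := fun n => zeval (subst [:: x]) (opp_poly p_pr n).

Lemma ghost_subst (s : seq W) j n :
  zeval (subst s) (ghost p n (zgen j)) = ghost p n (nth (fun=> 0) s j).
Proof.
by rewrite ghost_map; apply: eq_ghost => i _; rewrite /= zeval_var.
Qed.

Lemma ghost0 n : ghost p n witt_zero = 0.
Proof.
rewrite /ghost big1 // => i _.
by rewrite expr0n expn_eq0 eqn0Ngt prime_gt0 //= mulr0.
Qed.

Lemma ghost1 n : ghost p n witt_one = 1.
Proof.
rewrite /ghost big_ord_recl /= expr1n mul1r big1 ?addr0 // => i _.
by rewrite /witt_one /= expr0n expn_eq0 eqn0Ngt prime_gt0 //= mulr0.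
Qed.

Lemma ghostD n x y : ghost p n (witt_add x y) = ghost p n x + ghost p n y.
Proof.
have -> : ghost p n (witt_add x y) = zeval (subst [:: x; y]) (ghost p n (add_poly p_pr)).
  by rewrite ghost_map.
rewrite ghost_add_poly rmorphD; congr (_ + _).
  exact: (ghost_subst [:: x; y] 0).
exact: (ghost_subst [:: x; y] 1).
Qed.

Lemma ghostM n x y : ghost p n (witt_mul x y) = ghost p n x * ghost p n y.
Proof.
have -> : ghost p n (witt_mul x y) = zeval (subst [:: x; y]) (ghost p n (mul_poly p_pr)).
  by rewrite ghost_map.
rewrite ghost_mul_poly rmorphM; congr (_ * _).
  exact: (ghost_subst [:: x; y] 0).
exact: (ghost_subst [:: x; y] 1).
Qed.

Lemma ghostN n x : ghost p n (witt_opp x) = - ghost p n x.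
Proof.
have -> : ghost p n (witt_opp x) = zeval (subst [:: x]) (ghost p n (opp_poly p_pr)).
  by rewrite ghost_map.
rewrite ghost_opp_poly rmorphN; congr (- _).
exact: (ghost_subst [:: x] 0).
Qed.

End Ops.

Section Maps.
Variables (R S : comNzRingType) (f : {rmorphism R -> S}).

Lemma map_subst (s : seq (witt p_pr R)) :
  f \o subst s =1 subst [seq witt_map f x | x <- s].
Proof.
case=> j n; rewrite /subst /=.
by elim: s j => [|x s IH] [|j] /=; rewrite ?nth_nil ?rmorph0.
Qed.

Lemma witt_map0 : witt_map f (witt_zero R) = witt_zero S.
Proof. by apply/funext => n; apply: rmorph0. Qed.

Lemma witt_map1 : witt_map f (witt_one R) = witt_one S.
Proof. by apply/funext => n; apply: rmorph_nat. Qed.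

Lemma witt_mapD x y :
  witt_map f (witt_add x y) = witt_add (witt_map f x) (witt_map f y).
Proof.
by apply/funext => n; rewrite /witt_map zeval_comp; apply/eq_zeval/map_subst.
Qed.

Lemma witt_mapM x y :
  witt_map f (witt_mul x y) = witt_mul (witt_map f x) (witt_map f y).
Proof.
by apply/funext => n; rewrite /witt_map zeval_comp; apply/eq_zeval/map_subst.
Qed.

Lemma witt_mapN x : witt_map f (witt_opp x) = witt_opp (witt_map f x).
Proof.
by apply/funext => n; rewrite /witt_map zeval_comp; apply/eq_zeval/map_subst.
Qed.

End Maps.

Section WittLaws.
Variable R : comNzRingType.
Local Notation W := (witt p_pr R).
Implicit Types x y z : W.

Let gen j : witt p_pr zpoly := zgen j.

Lemma witt_gen (s : seq W) j : (j < size s)%N ->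
  witt_map (zeval (subst s)) (gen j) = nth (fun=> 0) s j.
Proof. by move=> _; apply/funext => n; rewrite /witt_map zeval_var. Qed.

(* Any three Witt vectors lift to a ring on which ghost maps are injective. *)
Lemma witt_gen3 x y z : exists (A : comNzRingType)
    (_ : forall u v : witt p_pr A, (forall n, ghost p n u = ghost p n v) -> u = v)
    (f : {rmorphism A -> R}) (x' y' z' : witt p_pr A),
  [/\ x = witt_map f x', y = witt_map f y' & z = witt_map f z'].
Proof.
exists zpoly; exists (fun u v uv => funext (ghost_inj p_pr zpoly_natI uv)).
exists (zeval (subst [:: x; y; z])), (gen 0), (gen 1), (gen 2).
by split; rewrite witt_gen.
Qed.

Definition gE := (ghostD, ghostM, ghostN, ghost0, ghost1).

Lemma witt_addA : associative (@witt_add R).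
Proof.
move=> x y z; have [A [Ainj [f [x' [y' [z' [-> -> ->]]]]]]] := witt_gen3 x y z.
by rewrite -!witt_mapD; congr witt_map; apply: Ainj => n; rewrite !gE addrA.
Qed.

Lemma witt_addC : commutative (@witt_add R).
Proof.
move=> x y; have [A [Ainj [f [x' [y' [_ [-> -> _]]]]]]] := witt_gen3 x y x.
by rewrite -!witt_mapD; congr witt_map; apply: Ainj => n; rewrite !gE addrC.
Qed.

Lemma witt_add0 : left_id (witt_zero R) (@witt_add R).
Proof.
move=> x; have [A [Ainj [f [x' [_ [_ [-> _ _]]]]]]] := witt_gen3 x x x; rewrite -(witt_map0 f).
by rewrite -!witt_mapD; congr witt_map; apply: Ainj => n; rewrite !gE add0r.
Qed.

Lemma witt_addN : left_inverse (witt_zero R) (@witt_opp R) (@witt_add R).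
Proof.
move=> x; have [A [Ainj [f [x' [_ [_ [-> _ _]]]]]]] := witt_gen3 x x x; rewrite -(witt_map0 f).
rewrite -witt_mapN -!witt_mapD; congr witt_map.
by apply: Ainj => n; rewrite !gE addNr.
Qed.

Lemma witt_mulA : associative (@witt_mul R).
Proof.
move=> x y z; have [A [Ainj [f [x' [y' [z' [-> -> ->]]]]]]] := witt_gen3 x y z.
by rewrite -!witt_mapM; congr witt_map; apply: Ainj => n; rewrite !gE mulrA.
Qed.

Lemma witt_mulC : commutative (@witt_mul R).
Proof.
move=> x y; have [A [Ainj [f [x' [y' [_ [-> -> _]]]]]]] := witt_gen3 x y x.
by rewrite -!witt_mapM; congr witt_map; apply: Ainj => n; rewrite !gE mulrC.
Qed.

Lemma witt_mul1 : left_id (witt_one R) (@witt_mul R).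
Proof.
move=> x; have [A [Ainj [f [x' [_ [_ [-> _ _]]]]]]] := witt_gen3 x x x; rewrite -(witt_map1 f).
by rewrite -!witt_mapM; congr witt_map; apply: Ainj => n; rewrite !gE mul1r.
Qed.

Lemma witt_mulD : left_distributive (@witt_mul R) (@witt_add R).
Proof.
move=> x y z; have [A [Ainj [f [x' [y' [z' [-> -> ->]]]]]]] := witt_gen3 x y z.
rewrite -!(witt_mapM, witt_mapD); congr witt_map.
by apply: Ainj => n; rewrite !gE mulrDl.
Qed.

Lemma witt_one_neq0 : witt_one R != witt_zero R.
Proof.
by apply/eqP => /(congr1 (@^~ 0%N)) /eqP; rewrite /witt_one /= oner_eq0.
Qed.

HB.instance Definition _ := GRing.isZmodule.Build W
  witt_addA witt_addC witt_add0 witt_addN.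
HB.instance Definition _ := GRing.Zmodule_isComNzRing.Build W
  witt_mulA witt_mulC witt_mul1 witt_mulD witt_one_neq0.

End WittLaws.

Section Functor.
Variables (R S : comNzRingType) (f : {rmorphism R -> S}).

Lemma witt_map_is_zmod_morphism : zmod_morphism (@witt_map p p_pr R S f).
Proof. by move=> x y; rewrite [LHS]witt_mapD witt_mapN. Qed.

Lemma witt_map_is_monoid_morphism : monoid_morphism (@witt_map p p_pr R S f).
Proof. by split=> [|x y]; [apply: witt_map1 | apply: witt_mapM]. Qed.

HB.instance Definition _ := GRing.isZmodMorphism.Build
  (witt p_pr R) (witt p_pr S) (@witt_map p p_pr R S f) witt_map_is_zmod_morphism.
HB.instance Definition _ := GRing.isMonoidMorphism.Build
  (witt p_pr R) (witt p_pr S) (@witt_map p p_pr R S f) witt_map_is_monoid_morphism.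

End Functor.

End WittRing.

(* The reduction W(K) -> K is the zeroth component, with kernel p W(K) for K
   perfect of characteristic p. *)
Definition lifts_frobenius (p : nat) (p_pr : prime p) (K : comNzRingType)
    (q : nat) (pi : witt p_pr K -> witt p_pr K) : Prop :=
  forall x, pi x 0%N = x 0%N ^+ q.

(* For algebraically closed K, ring endomorphisms of W(K) lifting x |-> x^(p^a)
   do exist, and such a lift is invertible. *)
Lemma frobenius_lift_exists (p : nat) (p_pr : prime p) (K : closedFieldType)
    (a : nat) : p \in [pchar K] ->
  exists pi piV : {rmorphism witt p_pr K -> witt p_pr K},
    [/\ lifts_frobenius (p ^ a) pi, cancel pi piV & cancel piV pi].
Proof.
move=> pK; pose q := (p ^ a)%N; pose f (x : K) := x ^+ q.
have q0 : (0 < q)%N by rewrite expn_gt0 prime_gt0.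
have qK : [pchar K].-nat q.
  by rewrite pnatX (pnatE _ p_pr) pK.
have fB : zmod_morphism f.
  move=> x y; rewrite /f exprDn_pchar //; congr (_ + _).
  by apply/eqP; rewrite -addr_eq0 -exprDn_pchar // addNr expr0n gtn_eqF.
have fM : monoid_morphism f.
  by split=> [|x y]; rewrite /f ?expr1n ?exprMn.
pose fZ := GRing.isZmodMorphism.Build K K f fB.
pose fR := GRing.isMonoidMorphism.Build K K f fM.
pose F : {rmorphism K -> K} := HB.pack f fZ fR.
have /choice[g fg] : forall y, exists x, f x = y.
  move=> y; have [|x /rootP] := @closed_rootP K ('X^q - y%:P) _.
    by rewrite size_XnsubC // -lt0n.
  by rewrite hornerD hornerN hornerXn hornerC => /subr0_eq; exists x.
have gf : cancel f g.
  move=> x; have /eqP := fg (f x); rewrite -subr_eq0 -fB /f expf_eq0 q0 subr_eq0.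
  by move/eqP.
pose gZ := GRing.isZmodMorphism.Build K K g (can2_zmod_morphism (f := F) gf fg).
pose gR := GRing.isMonoidMorphism.Build K K g (can2_monoid_morphism (f := F) gf fg).
pose G : {rmorphism K -> K} := HB.pack g gZ gR.
exists (witt_map F), (witt_map G); split=> x //; apply/funext => n.
- exact: gf.
- exact: fg.
Qed.

(* Continuity for the p-adic topologies, in which the x + p^n A form a basis of
   neighbourhoods of x. *)
Definition padic_continuous (p : nat) (A B : comNzRingType) (f : A -> B) : Prop :=
  forall x n, exists m, forall y, cong p m y x -> cong p n (f y) (f x).

(* W(K) is a W(k)-module through W(iota). *)
Definition witt_linear (p : nat) (p_pr : prime p) (k K : comNzRingType)
    (iota : k -> K) (tau : witt p_pr K -> witt p_pr K) : Prop :=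
  (forall x y, tau (x + y) = tau x + tau y) /\
  (forall c x, tau (witt_map iota c * x) = witt_map iota c * tau x).

(* tauL is the restriction of tau to W(L), embedded in W(K) by W(j). *)
Definition restricts_to (p : nat) (p_pr : prime p) (L K : Type) (j : L -> K)
    (tau : witt p_pr K -> witt p_pr K) (tauL : witt p_pr L -> witt p_pr L) : Prop :=
  forall x, tau (witt_map j x) = witt_map j (tauL x).

(* j embeds L in K as an extension of (the image of) k. *)
Definition over_base (k : fieldType) (L : fieldExtType k) (K : nzRingType)
    (iota : k -> K) (j : L -> K) : Prop :=
  forall c : k, j c%:A = iota c.

Section Trace.
Variables (p : nat) (p_pr : prime p) (k : finFieldType) (L : fieldExtType k).
Variable E : {subfield L}.

(* The trace of W(L) over W(E), with Gal(Frac W(L) / Frac W(E)) identified with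
   Gal(L / E) by functoriality of W: the sum of the Galois conjugates. The type
   [finvect_type L] is L with its structure of normal extension of the finite
   field k, which is what 'Gal requires. *)
Definition gal_sum (x : witt p_pr L) : witt p_pr L :=
  \sum_(g in 'Gal({: finvect_type L} / E)%g) witt_map (g : L -> L) x.

(* The conjugates sum to an element of the subring W(E) ([witt_traceE]), so the
   choice of the projection [vsproj] is immaterial. *)
Definition witt_trace (x : witt p_pr L) : witt p_pr (subvs_of E) :=
  witt_map (vsproj E) (gal_sum x).

Lemma witt_traceE x : witt_map vsval (witt_trace x) = gal_sum x.
Proof.
apply/funext => n; rewrite /witt_trace /witt_map vsprojK //.
have /galois_fixedField/(congr1 (fun V : {vspace finvect_type L} => gal_sum x n \in V)) :=
  @finField_galois k (finvect_type L) E {: finvect_type L}%AS (subvf _).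
move=> <-.
have fixed h : h \in 'Gal({: finvect_type L} / E)%g ->
    witt_map (h : L -> L) (gal_sum x) = gal_sum x.
  move=> hG; rewrite /gal_sum.
  rewrite (raddf_sum (witt_map (h : {rmorphism L -> L}))) /=.
  rewrite [RHS](reindex_inj (mulIg h)) /=; apply: eq_big => [g|g gG].
    by rewrite groupMr.
  by apply/funext => m; rewrite /witt_map galM ?memvf.
apply/fixedFieldP; first exact: memvf.
by move=> h hG; rewrite -{2}(fixed h hG).
Qed.

End Trace.

(* Main.v *)
(** The trace condition and the stability of every W(E) follow from
    [tau pi = pi^-1 tau]: W(E) is the fixed module of a power of [pi], and the
    trace is a sum over a group of powers of [pi], which is invariant under
    inversion. Continuity follows from additivity.

    To get [tau], choose [e_n] in W(F_(q^n!)), n >= 0, with Tr e_(n+1) = e_n, such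
    that the residue of [e_n] has annihilator exactly X^(n!) - 1 in k[X], where X
    acts as the Frobenius; thus [e_n] generates a normal basis. Then [tau] is
    c(pi) e_n |-> c(pi^-1) e_n for [c] in W(k)[X]. Such elements are p-adically
    dense in W(kbar), and c(pi) e_n = 0 mod p^m only for [c] in the ideal generated
    by X^(n!) - 1 and p^m, which is stable under X |-> X^-1 modulo X^(n!) - 1. *)

From HB Require Import structures.
Require Import Defs.
From mathcomp Require Import all_boot all_order all_algebra all_fingroup all_field.
From mathcomp Require Import finmap boolp ring.
From mathcomp.multinomials Require Import monalg.

Set Implicit Arguments.
Unset Strict Implicit.
Unset Printing Implicit Defensive.

Import GRing.Theory.
Local Open Scope ring_scope.

(** * Witt vectors over a perfect field *)

(** Induction on [n]: congruences mod [p] of the lower components make the terms p^i u_i^(p^(n-i))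
    and p^i v_i^(p^(n-i)) agree mod p^(n+1). What is left is p^n u_n = p^n v_n mod p^(n+1), and p^n
    cancels. *)
Lemma cong_ghost_comp (p : nat) (p_pr : prime p) (A : comNzRingType) :
  (forall (n : nat) (a b : A), (0 < n)%N -> n%:R * a = n%:R * b -> a = b) ->
  forall u v : nat -> A,
  (forall n, cong p n.+1 (ghost p n u) (ghost p n v)) ->
  forall n, cong p 1 (u n) (v n).
Proof.
move=> A_natI u v uv n; have [m] := ubnP n; elim: m n => // m IH n; rewrite ltnS => nm.
have /congN : cong p n.+1 (\sum_(i < n) (p ^ i)%:R * u i ^+ (p ^ (n - i)))
                          (\sum_(i < n) (p ^ i)%:R * v i ^+ (p ^ (n - i))).
  apply: cong_sum => i _.
  have := cong_exppX p_pr (n - i) (IH i (leq_trans (ltn_ord i) nm)).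
  by move/(cong_scale i); rewrite addn1 addnS subnKC // ltnW.
move/(congD (uv n)); rewrite /ghost !big_ord_recr /= ![_ + _ - _]addrC !addKr.
rewrite subnn !expr1 => -[c Ec]; exists c.
by apply: (A_natI (p ^ n)%N); rewrite ?expn_gt0 ?prime_gt0 // Ec mulrDr mulrA -natrM -expnD addn1.
Qed.

Section WittFacts.
Variables (p : nat) (p_pr : prime p).

Lemma witt_comp0_zmod (R : comNzRingType) :
  zmod_morphism (fun x : witt p_pr R => x 0%N).
Proof.
have g0 (x : witt p_pr R) : x 0%N = ghost p 0 x.
  by rewrite /ghost big_ord1 expr1 mul1r.
by move=> x y; rewrite !g0 [LHS]ghostD ghostN.
Qed.

Lemma witt_comp0_monoid (R : comNzRingType) :
  monoid_morphism (fun x : witt p_pr R => x 0%N).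
Proof.
have g0 (x : witt p_pr R) : x 0%N = ghost p 0 x.
  by rewrite /ghost big_ord1 expr1 mul1r.
by split=> [//|x y]; rewrite !g0 [LHS]ghostM.
Qed.

Definition residue (R : comNzRingType) (x : witt p_pr R) : R := x 0%N.

HB.instance Definition _ (R : comNzRingType) := GRing.isZmodMorphism.Build
  (witt p_pr R) R (@residue R) (@witt_comp0_zmod R).
HB.instance Definition _ (R : comNzRingType) := GRing.isMonoidMorphism.Build
  (witt p_pr R) R (@residue R) (@witt_comp0_monoid R).

(** The Teichmueller representative of [a], serving as a section of [residue] that sends 0 to 0. *)
Definition witt_const (R : comNzRingType) (a : R) : witt p_pr R :=
  fun n => if n is 0%N then a else 0.

Lemma ghost_natr (R : comNzRingType) n m :
  ghost p n (m%:R : witt p_pr R) = m%:R.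
Proof.
elim: m => [|m IH]; first exact: ghost0.
by rewrite -addn1 !natrD [LHS]ghostD IH; congr (_ + _); apply: ghost1.
Qed.

Section Torsionfree.
Variable A : comNzRingType.
Hypothesis A_natI :
  forall (n : nat) (a b : A), (0 < n)%N -> n%:R * a = n%:R * b -> a = b.
Implicit Types y z : witt p_pr A.

Lemma witt_add_low_torsionfree m y z z' : (forall i, (i < m)%N -> z i = z' i) ->
  forall i, (i < m)%N -> (y + z) i = (y + z') i.
Proof.
move=> zz' i im.
have G n : (n <= i)%N -> ghost p n (y + z) = ghost p n (y + z').
  move=> ni; rewrite [LHS]ghostD [RHS]ghostD; congr (_ + _).
  by apply: eq_ghost => k kn; rewrite zz' // (leq_ltn_trans (leq_trans kn ni) im).
exact: (ghost_injn p_pr A_natI G (leqnn i)).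
Qed.

(** The Witt vector (0, z_0^p, z_1^p, ...) has the same ghost components as p z up to the top term
    p^(n+1) z_n, so [cong_ghost_comp] compares the two. *)
Lemma witt_mulp_comp_torsionfree z n :
  cong p 1 ((p%:R * z) n) (if n is m.+1 then z m ^+ p else 0).
Proof.
pose v n := if n is m.+1 then z m ^+ p else 0.
apply: (cong_ghost_comp p_pr A_natI (v := v)) => {}n.
rewrite [ghost p n _]ghostM ghost_natr; case: n => [|n].
  by exists (z 0%N); rewrite /ghost !big_ord1 /v /= !expr1 mulr0 add0r !expn1 !mul1r.
exists (z n.+1); rewrite ghostS mulrDr mulrA -natrM -expnS; congr (_ + _).
rewrite [RHS]big_ord_recl /= expr0n expn_eq0 eqn0Ngt prime_gt0 //= mulr0 add0r.
rewrite mulr_sumr; apply: eq_bigr => i _; rewrite /bump /= add1n subSS.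
by rewrite mulrA -natrM -expnS -exprM -expnS -subSn // -ltnS.
Qed.

End Torsionfree.

(** Reduces statements over any [R] to integral polynomials, which are torsion-free, so that ghost
    components determine Witt vectors. *)
Lemma witt_lift3 (R : comNzRingType) m (y z z' : witt p_pr R) :
  (forall i, (i < m)%N -> z i = z' i) ->
  exists (A : comNzRingType) (_ : forall (n : nat) (a b : A),
      (0 < n)%N -> n%:R * a = n%:R * b -> a = b)
    (f : {rmorphism A -> R}) (Y Z Z' : witt p_pr A),
    [/\ y = witt_map f Y, z = witt_map f Z, z' = witt_map f Z' &
        forall i, (i < m)%N -> Z i = Z' i].
Proof.
move=> zz'; exists zpoly, zpoly_natI, (zeval (subst [:: y; z; z'])).
(* The lift of [z'] shares the variables of the lift of [z] below [m], which preserves the agreement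
   there. *)
exists (zgen 0), (zgen 1), (fun i => zvar (if (i < m)%N then 1%N else 2%N, i)).
split.
- by apply/funext => n; apply/esym/(zeval_var _ (0%N, n)).
- by apply/funext => n; apply/esym/(zeval_var _ (1%N, n)).
- apply/funext => n; apply/esym; apply: etrans (zeval_var _ _) _.
  by case: ifP => // nm; apply: zz'.
- by move=> i ->.
Qed.

Lemma witt_add_low (R : comNzRingType) m (y z z' : witt p_pr R) :
  (forall i, (i < m)%N -> z i = z' i) ->
  forall i, (i < m)%N -> (y + z) i = (y + z') i.
Proof.
move=> /(witt_lift3 y)[A [A_natI [f [Y [Z [Z' [-> -> -> ZZ']]]]]]] i im.
by rewrite -!rmorphD; congr (f _); apply: witt_add_low_torsionfree im.
Qed.

(** In characteristic p the universal congruence mod [p] becomes an equality: multiplication by p is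
    Frobenius followed by the shift. *)
Lemma witt_mulp_comp (K : comNzRingType) (x : witt p_pr K) n :
  p \in [pchar K] -> (p%:R * x) n = if n is m.+1 then x m ^+ p else 0.
Proof.
move=> pK; have [|A [A_natI [f [X [_ [_ [-> _ _ _]]]]]]] := @witt_lift3 K 0 x x x.
  by [].
have [c Ec] := witt_mulp_comp_torsionfree A_natI X n.
have -> : (p%:R * witt_map f X) n = f ((p%:R * X) n).
  by rewrite -(rmorph_nat (witt_map f)) -rmorphM.
rewrite Ec.
rewrite rmorphD rmorphM rmorph_nat expn1 (pcharf0 pK) mul0r addr0.
by case: (n) => [|m]; rewrite ?rmorph0 // rmorphXn.
Qed.

Section Perfect.
Variables (K : fieldType) (pK : p \in [pchar K]).
Hypothesis K_perf : forall y : K, exists x, x ^+ p = y.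
Local Notation W := (witt p_pr K).
Implicit Types x y z : W.

Lemma witt_natX_low m z i : (i < m)%N -> ((p ^ m)%:R * z) i = 0.
Proof.
elim: m i => [//|m IH] i im; rewrite expnS natrM -mulrA witt_mulp_comp //.
by case: i im => // i im; rewrite IH // expr0n eqn0Ngt prime_gt0.
Qed.

Lemma witt_low_natX m z :
  (forall i, (i < m)%N -> z i = 0) -> exists c, z = (p ^ m)%:R * c.
Proof.
elim: m z => [|m IH] z zm; first by exists z; rewrite mul1r.
have /choice[c Ec] : forall n, exists a, a ^+ p = z n.+1 by move=> n; apply: K_perf.
have [i im|d Ed] := IH c.
  by apply/eqP; have /eqP := Ec i; rewrite zm // expf_eq0 prime_gt0.
exists d; rewrite expnS natrM -mulrA -Ed; apply/funext => n.
by rewrite witt_mulp_comp //; case: n => [|n]; rewrite ?Ec // zm.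
Qed.

(** Identifies the p-adic topology with the product topology on components. One direction is
    [witt_natX_low]; the other divides by p^m, by shifting down and extracting p-th roots. *)
Lemma witt_congP m x y : cong p m x y <-> forall i, (i < m)%N -> x i = y i.
Proof.
split=> [[c ->] i im|xy].
  by rewrite -[in RHS](addr0 y); apply: witt_add_low im => k /witt_natX_low->.
have [i im|c Ec] := @witt_low_natX m (- y + x).
  by rewrite (witt_add_low (z' := y) _ xy im) addNr.
by exists c; rewrite -Ec addNKr.
Qed.

Lemma witt_cong_eq x y : (forall m, cong p m x y) -> x = y.
Proof. by move=> xy; apply/funext => i; have /witt_congP := xy i.+1; apply. Qed.

Lemma witt_mulp_cong m x y :
  cong p m.+1 (p%:R * x) (p%:R * y) -> cong p m x y.
Proof.
move=> /witt_congP xy; apply/witt_congP => i im.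
have := xy i.+1; rewrite ltnS !witt_mulp_comp // => /(_ im).
exact: (fmorph_inj (pFrobenius_aut pK)).
Qed.

Lemma witt_residue0 x : residue x = 0 -> exists c, x = p%:R * c.
Proof.
by move=> x0; have [[|//]|c] := @witt_low_natX 1 x; rewrite ?expn1 //; exists c.
Qed.

Lemma witt_complete (u : nat -> W) : (forall m, cong p m (u m.+1) (u m)) ->
  exists y, forall m, cong p m y (u m).
Proof.
(* Component [i] of [u m] is constant from m = i + 1 on, so the diagonal is the limit. *)
move=> uc; exists (fun i => u i.+1 i) => m; apply/witt_congP => i im.
rewrite -(subnKC im); elim: (m - i.+1)%N => [|d IH]; rewrite ?addn0 //.
rewrite IH; have /witt_congP := uc (i.+1 + d)%N; rewrite addnS => -> //.
by rewrite addSn ltnS leq_addr.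
Qed.

Lemma perfX n (b : K) : exists a : K, a ^+ (p ^ n) = b.
Proof.
elim: n b => [|n IH] b; first by exists b.
by have [c <-] := K_perf b; have [a <-] := IH c; exists a; rewrite -exprM expnSr.
Qed.

(* An element is a [p^r]-th power up to a multiple of [p], and [p^r]-th powers
   improve congruences mod [p] to congruences mod [p^(r+1)]. *)
Lemma witt_rmorph_cong (A : comNzRingType) (f g : {rmorphism W -> A}) :
  (forall x, cong p 1 (f x) (g x)) -> forall r x, cong p r (f x) (g x).
Proof.
move=> fg; elim=> [|r IH] x; first by exists (f x - g x); rewrite mul1r addrC subrK.
have [b Eb] := perfX r (residue x); pose y : W := witt_const b.
have [z Ez] : exists z, x - y ^+ (p ^ r) = p%:R * z.
  by apply: witt_residue0; rewrite rmorphB rmorphXn /= {2}/residue Eb subrr.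
have -> : x = y ^+ (p ^ r) + p%:R * z by rewrite -Ez addrC subrK.
rewrite !rmorphD !rmorphM !rmorph_nat !rmorphXn; apply: congD.
  by rewrite -addn1; apply: cong_exppX.
by have /(cong_scale 1) := IH z; rewrite expn1 add1n.
Qed.

(* Successive approximation modulo powers of [p]. *)
Lemma witt_surj (u : {additive W -> W}) :
  (forall b : K, exists x, residue (u x) = b) -> forall x, exists y, u y = x.
Proof.
move=> us x.
have uM n z : u (n%:R * z) = n%:R * u z by rewrite !mulr_natl raddfMn.
have /choice[s Es] : forall z, exists y, exists z', z = u y + p%:R * z'.
  move=> z; have [y Ey] := us (residue z); exists y.
  have [|c Ec] := @witt_residue0 (z - u y); first by rewrite rmorphB /= Ey subrr.
  by exists c; rewrite -Ec addrC subrK.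
have /choice[t Et] := Es.
(* [s z] solves the equation for [z] modulo p, and [t z] is the remaining error divided by p; the
   partial sums [e n] therefore solve it modulo p^n. *)
pose e n := \sum_(i < n) (p ^ i)%:R * s (iter i t x).
have Ee n : x = u (e n) + (p ^ n)%:R * iter n t x.
  elim: n => [|n IH]; first by rewrite /e big_ord0 raddf0 add0r mul1r.
  rewrite /e big_ord_recr /= raddfD /= -/(e n) uM -addrA expnSr natrM -mulrA -mulrDr.
  by rewrite -Et.
have [|y Ey] := @witt_complete e.
  by move=> m; exists (s (iter m t x)); rewrite /e big_ord_recr.
exists y; apply: witt_cong_eq => m; have [c ->] := Ey m.
have := Ee m; move: (e m) (iter m t x) => v w ->; exists (u c - w).
by rewrite raddfD /= uM; ring.
Qed.

End Perfect.
End WittFacts.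

(** * Polynomials in a Frobenius lift *)

Section Act.
Variables (R S : comNzRingType) (f : {rmorphism R -> S}) (phi : {rmorphism S -> S}).
Implicit Types (c d : {poly R}) (x y : S).

(** The action of c(phi). When [phi] fixes the image of [f], it makes [S] an R[X]-module in which X
    acts as [phi] ([poly_actM]). *)
Definition poly_act c x : S := \sum_(i < size c) f c`_i * iter i phi x.

Lemma poly_act_widen n c x : (size c <= n)%N ->
  poly_act c x = \sum_(i < n) f c`_i * iter i phi x.
Proof.
move=> cn; rewrite /poly_act (big_ord_widen n (fun i => f c`_i * iter i phi x)) // big_mkcond.
by apply: eq_bigr => i _; case: ltnP => // ci; rewrite nth_default // rmorph0 mul0r.
Qed.

Lemma iter_rmorphD i x y : iter i phi (x + y) = iter i phi x + iter i phi y.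
Proof. by elim: i => //= i ->; rewrite rmorphD. Qed.

Lemma iter_rmorphM i x y : iter i phi (x * y) = iter i phi x * iter i phi y.
Proof. by elim: i => //= i ->; rewrite rmorphM. Qed.

Lemma iter_rmorph_nat i n : iter i phi n%:R = n%:R.
Proof. by elim: i => //= i ->; rewrite rmorph_nat. Qed.

Lemma poly_actDr c x y : poly_act c (x + y) = poly_act c x + poly_act c y.
Proof.
by rewrite -big_split; apply: eq_bigr => i _; rewrite iter_rmorphD mulrDr.
Qed.

Lemma poly_act_natr c n x : poly_act c (n%:R * x) = n%:R * poly_act c x.
Proof.
rewrite mulr_sumr; apply: eq_bigr => i _.
by rewrite iter_rmorphM iter_rmorph_nat mulrCA.
Qed.

Lemma poly_act_is_zmod_morphism c : zmod_morphism (poly_act c).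
Proof.
have poly_act0 : poly_act c 0 = 0 by have := poly_act_natr c 0 0; rewrite !mul0r.
have poly_actN x : poly_act c (- x) = - poly_act c x.
  by apply/eqP; rewrite -addr_eq0 -poly_actDr addNr poly_act0.
by move=> x y; rewrite poly_actDr poly_actN.
Qed.

HB.instance Definition _ c :=
  GRing.isZmodMorphism.Build S S (poly_act c) (poly_act_is_zmod_morphism c).

Lemma poly_actDl c d x : poly_act (c + d) x = poly_act c x + poly_act d x.
Proof.
pose n := maxn (size c) (size d).
rewrite (poly_act_widen _ (size_polyD c d)) !(@poly_act_widen n) ?leq_maxl ?leq_maxr //.
by rewrite -big_split; apply: eq_bigr => i _; rewrite coefD rmorphD mulrDl.
Qed.

Lemma poly_act0l x : poly_act 0 x = 0.
Proof. by rewrite /poly_act size_poly0 big_ord0. Qed.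

Lemma poly_actNl c x : poly_act (- c) x = - poly_act c x.
Proof. by apply/eqP; rewrite -addr_eq0 -poly_actDl addNr poly_act0l. Qed.

Lemma poly_actBl c d x : poly_act (c - d) x = poly_act c x - poly_act d x.
Proof. by rewrite poly_actDl poly_actNl. Qed.

Lemma poly_act_C a x : poly_act a%:P x = f a * x.
Proof. by rewrite (poly_act_widen _ (size_polyC_leq1 a)) big_ord1 coefC. Qed.

Lemma poly_act_1 x : poly_act 1 x = x.
Proof. by rewrite -[1]/(1%:P) poly_act_C rmorph1 mul1r. Qed.

Lemma poly_act_CM a c x : poly_act (a%:P * c) x = f a * poly_act c x.
Proof.
have le : (size (a%:P * c)%R <= size c)%N by rewrite mul_polyC size_scale_leq.
rewrite (poly_act_widen _ le) mulr_sumr; apply: eq_bigr => i _.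
by rewrite coefCM rmorphM mulrA.
Qed.

Lemma poly_act_MX c x : poly_act (c * 'X) x = poly_act c (phi x).
Proof.
have le : (size (c * 'X)%R <= (size c).+1)%N.
  by have [->|c0] := eqVneq c 0; rewrite ?mul0r ?size_poly0 // size_mulX.
rewrite (poly_act_widen _ le) big_ord_recl coefMX rmorph0 mul0r add0r.
by apply: eq_bigr => i _; rewrite coefMX /= -iterSr.
Qed.

Lemma poly_act_nat n c x : poly_act (n%:R * c) x = n%:R * poly_act c x.
Proof. by rewrite -polyC_natr poly_act_CM rmorph_nat. Qed.

Hypothesis phif : forall a, phi (f a) = f a.

Lemma poly_actZ c a x : poly_act c (f a * x) = f a * poly_act c x.
Proof.
have fa i : iter i phi (f a) = f a by elim: i => //= i ->.
by rewrite mulr_sumr; apply: eq_bigr => i _; rewrite iter_rmorphM fa mulrCA.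
Qed.

Lemma poly_actM c d x : poly_act (c * d) x = poly_act c (poly_act d x).
Proof.
elim/poly_ind: d x => [|d a IH] x; first by rewrite mulr0 !poly_act0l raddf0.
rewrite mulrDr mulrA [c * _%:P]mulrC !poly_actDl poly_act_CM poly_act_C poly_act_MX IH.
by rewrite -poly_actZ poly_act_MX -raddfD.
Qed.

Lemma poly_actC c d x : poly_act c (poly_act d x) = poly_act d (poly_act c x).
Proof. by rewrite -!poly_actM mulrC. Qed.

Lemma poly_act_Xn n x : poly_act 'X^n x = iter n phi x.
Proof.
elim: n x => [|n IH] x; first by rewrite expr0 poly_act_1.
by rewrite exprSr poly_act_MX IH -iterSr.
Qed.

Lemma poly_act_Xn1 n x : poly_act ('X^n - 1) x = iter n phi x - x.
Proof. by rewrite poly_actBl poly_act_Xn poly_act_1. Qed.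

(** Meant for n = N - 1, where X^n represents the inverse of X modulo X^N - 1. *)
Lemma poly_act_comp_Xn c n x : poly_act (c \Po 'X^n) x = \sum_(i < size c) f c`_i * iter (n * i) phi x.
Proof.
rewrite comp_polyE (big_morph (poly_act^~ x) (fun c d => poly_actDl c d x) (poly_act0l x)).
by apply: eq_bigr => i _; rewrite -mul_polyC poly_act_CM -exprM poly_act_Xn.
Qed.

End Act.

Lemma poly_act_map (R S R' S' : comNzRingType) (f : {rmorphism R -> S})
    (f' : {rmorphism R' -> S'}) (phi : {rmorphism S -> S}) (phi' : {rmorphism S' -> S'})
    (u : {rmorphism R -> R'}) (v : {rmorphism S -> S'}) c x :
  (forall a, v (f a) = f' (u a)) -> (forall y, v (phi y) = phi' (v y)) ->
  v (poly_act f phi c x) = poly_act f' phi' (map_poly u c) (v x).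
Proof.
move=> vf vphi; rewrite [RHS](@poly_act_widen _ _ _ _ (size c)) ?size_poly // /poly_act rmorph_sum.
apply: eq_bigr => i _; rewrite rmorphM vf coef_map; congr (_ * _).
by elim: (i : nat) => //= j <-; apply: vphi.
Qed.

(** * Annihilators in k[X] of elements of an algebraically closed field, with X acting as
    Frobenius *)

Section Annihilator.
Variables (p a : nat) (k : finFieldType) (K : closedFieldType) (iota : {rmorphism k -> K}).
Variable F : {rmorphism K -> K}.
Let q := (p ^ a)%N.
Hypothesis q_gt1 : (1 < q)%N.
Hypothesis FE : forall x, F x = x ^+ q.
Hypothesis F_iota : forall c, F (iota c) = iota c.
Local Notation poly_act := (poly_act iota F).
Implicit Types (f g h P : {poly k}) (x y e : K).

Lemma iter_frobE i x : iter i F x = x ^+ (q ^ i).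
Proof. by elim: i => [|i IH] /=; rewrite ?expr1 // IH FE -exprM -expnSr. Qed.

Lemma qX_gt0 i : (0 < q ^ i)%N.
Proof. by rewrite expn_gt0 (ltnW q_gt1). Qed.

Lemma qX_pred_gt0 i : (0 < i)%N -> (0 < (q ^ i).-1)%N.
Proof. by move=> i0; rewrite -subn1 subn_gt0 -(expn0 q) ltn_exp2l. Qed.

(** P(F) y is the polynomial expression sum_i P_i y^(q^i) in y, so a preimage of [x] is a root of a
    nonconstant polynomial. *)
Lemma poly_act_surj P x : P != 0 -> exists y, poly_act P y = x.
Proof.
move=> P0; pose L := \sum_(i < size P) iota P`_i *: 'X^(q ^ i) - x%:P.
have [|y] := closed_rootP L _; last first.
  rewrite /root !hornerE horner_sum subr_eq0 => /eqP <-; exists y.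
  by apply: eq_bigr => i _; rewrite hornerZ hornerXn iter_frobE.
pose d := (size P).-1; have Ed : size P = d.+1 by rewrite prednK // size_poly_gt0.
(* The coefficient of degree q^d > 0 is the leading coefficient of [P]; its nonvanishing shows that
   [L] is not constant. *)
suff : L`_(q ^ d) != 0.
  by apply: contraNneq => /eqP/size_poly1P[b _ ->]; rewrite coefC (gtn_eqF (qX_gt0 d)).
rewrite coefB coefC (gtn_eqF (qX_gt0 d)) subr0 coef_sum Ed.
rewrite (bigD1 ord_max) //= coefZ coefXn eqxx mulr1 big1 ?addr0 => [|i ni].
  by rewrite fmorph_eq0 -[P`_d]/(lead_coef P) lead_coef_eq0.
rewrite coefZ coefXn eqn_exp2l // eq_sym.
by rewrite -val_eqE /= in ni; rewrite (negPf ni) mulr0.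
Qed.

(** P(F) z divided by z is a polynomial in z of degree q^d - 1 > 0, with d the degree of [P], and
    with constant term [P_0], so its roots are nonzero. *)
Lemma poly_act_ker P : (1 < size P)%N -> P`_0 != 0 -> exists2 z, z != 0 & poly_act P z = 0.
Proof.
move=> P1 P0; pose L := \sum_(i < size P) iota P`_i *: 'X^((q ^ i).-1).
have [|z] := closed_rootP L _; last first.
  rewrite /root horner_sum => /eqP Lz; exists z.
    apply: contra_eq_neq Lz => ->; rewrite -(prednK (ltnW P1)) big_ord_recl big1.
      by rewrite addr0 hornerZ hornerXn /= ?expn0 expr0 mulr1 fmorph_eq0.
    by move=> i _; rewrite hornerZ hornerXn expr0n (gtn_eqF (qX_pred_gt0 _)) ?mulr0.
  rewrite /poly_act -[RHS](mulr0 z) -[X in _ = _ * X]Lz mulr_sumr; apply: eq_bigr => i _.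
  rewrite hornerZ hornerXn mulrCA -exprS prednK ?iter_frobE //.
  exact: qX_gt0.
pose d := (size P).-1; have Ed : size P = d.+1 by rewrite prednK // ltnW.
have d_gt0 : (0 < d)%N by rewrite -ltnS -Ed.
suff : L`_((q ^ d).-1) != 0.
  by apply: contraNneq => /eqP/size_poly1P[b _ ->]; rewrite coefC (gtn_eqF (qX_pred_gt0 d_gt0)).
rewrite coef_sum Ed (bigD1 ord_max) //= coefZ coefXn eqxx mulr1 big1 ?addr0 => [|i ni].
  by rewrite fmorph_eq0 -[P`_d]/(lead_coef P) lead_coef_eq0 -size_poly_gt0 ltnW.
rewrite coefZ coefXn -(inj_eq succn_inj) !(prednK (qX_gt0 _)) eqn_exp2l // eq_sym.
by rewrite -val_eqE /= in ni; rewrite (negPf ni) mulr0.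
Qed.

Definition ann_by e f := forall h, poly_act h e = 0 <-> f %| h.

(* Any [y] with [P y = e] works as soon as [f y], which [P] kills, is nonzero;
   if [f y = 0], then [P] does not divide [f] and an element of the kernel of [P]
   corrects [y]. *)
Lemma ann_by_irr e f P : f != 0 -> irreducible_poly P -> P`_0 != 0 ->
  ann_by e f -> exists2 e', poly_act P e' = e & ann_by e' (P * f).
Proof.
move=> f0 irrP P0 ef; have [P1 _] := irrP.
have Pn0 : P != 0 by rewrite -size_poly_gt0 ltnW.
(* By Bezout, a nonzero element killed by the irreducible [P] is killed only by multiples of [P]. *)
have cop h z : poly_act P z = 0 -> z != 0 -> poly_act h z = 0 -> P %| h.
  move=> Pz z0 hz; apply: contraNT z0; rewrite -irreducible_poly_coprime //.
  case/Bezout_eq1_coprimepP=> -[u v] /= uv.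
  by rewrite -[z](poly_act_1 iota F) -uv poly_actDl !poly_actM // Pz hz !raddf0 addr0.
have ff : poly_act f e = 0 by apply/ef.
suff [y Py fy] : exists2 y, poly_act P y = e & poly_act f y != 0.
  exists y => // h; split=> [hy|/dvdpP[g ->]]; last first.
    by rewrite mulrA -mulrA [P * f]mulrC !poly_actM // Py ff raddf0.
  (* If [h] kills [y], it kills e = P y, so h = m f; then [m] kills f y, which is nonzero and killed
     by [P], whence [P] divides [m]. *)
  have /ef/dvdpP[m Em] : poly_act h e = 0 by rewrite -Py poly_actC // hy raddf0.
  rewrite Em dvdp_mul2r //; apply: (cop m (poly_act f y)) => //.
    by rewrite poly_actC // Py.
  by rewrite -poly_actM // -Em.
have [y Py] := poly_act_surj e Pn0.
have [fy|] := eqVneq (poly_act f y) 0; last by exists y.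
have [z z0 Pz] := poly_act_ker P1 P0; exists (y + z); first by rewrite raddfD /= Py Pz addr0.
(* If f z = 0, then f = m P, so m e = f y = 0 and [f] divides [m], which contradicts the degrees. *)
rewrite raddfD /= fy add0r; apply/eqP => /(cop _ _ Pz z0)/dvdpP[m Em].
have fm : f %| m by apply/ef; rewrite -Py -poly_actM // -Em.
have m0 : m != 0 by apply: contraNneq f0 => m0; rewrite Em m0 mul0r.
have := dvdp_leq m0 fm; rewrite Em size_mul // -subn1 -addnBA ?(ltnW P1) //.
by rewrite -[X in (_ <= X)%N]addn0 leq_add2l leqn0 subn_eq0 leqNgt P1.
Qed.

(** Induction on the size of [g]: a constant rescales [e], an irreducible [g] is [ann_by_irr], and
    for g = r d one solves for [d] and then for [r]. *)
Lemma ann_by_mul g e f : f != 0 -> g`_0 != 0 -> ann_by e f ->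
  exists2 e', poly_act g e' = e & ann_by e' (g * f).
Proof.
have [n] := ubnP (size g); elim: n g e f => // n IH g e f; rewrite ltnS => gn f0 g0 ef.
have gn0 : g != 0 by apply: contraNneq g0 => ->; rewrite coef0.
have [g1|g1] := leqP (size g) 1.
  move: g0 (size1_polyC g1); move: g`_0 => c c0 ->.
  exists (iota c^-1 * e); first by rewrite poly_act_C mulrA -rmorphM divff // rmorph1 mul1r.
  move=> h; rewrite poly_actZ // mul_polyC; split=> [/eqP|].
    rewrite mulf_eq0 fmorph_eq0 invr_eq0 (negPf c0) /= => /eqP/ef fh.
    by rewrite dvdpZl.
  by rewrite dvdpZl // => /ef->; rewrite mulr0.
have [irr|] := EM (irreducible_poly g); first exact: ann_by_irr.
move=> nirr; have [d dg [d1 dng]] : exists2 d, d %| g & size d != 1%N /\ ~ d %= g.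
  apply: contra_notP nirr => H; split=> // d d1 dg; apply: contra_notT H => /negP dng.
  by exists d.
have /dvdpP[r Er] := dg; move: g0; rewrite Er coef0M mulf_eq0 negb_or => /andP[r0 d0].
have rn0 : r != 0 by apply: contraNneq r0 => ->; rewrite coef0.
have dn0 : d != 0 by apply: contraNneq d0 => ->; rewrite coef0.
have sd : (size d < size g)%N.
  by rewrite ltn_neqAle dvdp_leq // andbT dvdp_size_eqp //; apply/negP.
have sr : (size r < size g)%N.
  rewrite Er size_mul // -subn1 -addnBA ?size_poly_gt0 // -[X in (X < _)%N]addn0.
  rewrite ltn_add2l subn_gt0 ltn_neqAle eq_sym d1 size_poly_gt0 //.
have [e1 E1 A1] := IH d e f (leq_trans sd gn) f0 d0 ef.
have [|e2 E2 A2] := IH r e1 (d * f) (leq_trans sr gn) _ r0 A1.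
  by rewrite mulf_neq0.
by exists e2; [rewrite mulrC poly_actM // E2 | rewrite -mulrA].
Qed.

(* The multiples of [e] and the roots of [X^(q^N) - X] are equal in number. *)
Lemma ann_by_span N e x : (0 < N)%N -> #|k| = q -> ann_by e ('X^N - 1) ->
  x ^+ (q ^ N) = x -> exists c, poly_act c e = x.
Proof.
move=> N0 kq eN xN; pose s := [seq poly_act (rVpoly v) e | v <- enum {: 'rV[k]_N}].
suff : x \in s by case/mapP=> v _ ->; exists (rVpoly v).
apply: contraT => xs.
(* Distinct polynomials of degree below [N] act differently on [e], since their difference is not a
   multiple of X^N - 1. *)
have us : uniq s.
  rewrite map_inj_uniq ?enum_uniq // => u v; move/eqP; rewrite -subr_eq0 -poly_actBl.
  move/eqP/eN; rewrite -raddfB => uv; apply/eqP; rewrite -subr_eq0; apply/eqP.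
  apply: (can_inj rVpolyK); rewrite raddf0; apply: contraTeq uv => uv0.
  rewrite gtNdvdp //; apply: leq_ltn_trans (size_poly _ _) _.
  by rewrite size_XnsubC.
have qN1 : (1 < q ^ N)%N by rewrite -(expn0 q) ltn_exp2l.
have sL : size ('X^(q ^ N) - 'X : {poly K}) = (q ^ N).+1.
  by rewrite size_polyDl ?size_polyXn // size_polyN size_polyX.
have rt y : y ^+ (q ^ N) = y -> root ('X^(q ^ N) - 'X) y.
  by move=> yN; rewrite /root !hornerE yN subrr.
have : (size (x :: s) < size ('X^(q ^ N) - 'X : {poly K})%R)%N.
  apply: max_poly_roots; rewrite -?size_poly_gt0 ?sL //= ?xs //.
  rewrite rt //=; apply/allP=> _ /mapP[v _ ->]; apply: rt; apply/eqP.
  rewrite -iter_frobE -subr_eq0 -(poly_act_Xn1 iota); apply/eqP.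
  by rewrite poly_actC // (_ : poly_act _ e = 0) ?raddf0 //; apply/eN.
by rewrite sL /= size_map -cardE card_mx mul1n kq ltnn.
Qed.

End Annihilator.

(** * Compatible normal generators and the conjugation *)

Lemma cong_rmorph (p : nat) (R S : comNzRingType) (f : {rmorphism R -> S}) n a b :
  cong p n a b -> cong p n (f a) (f b).
Proof. by case=> c ->; exists (f c); rewrite rmorphD rmorphM rmorph_nat. Qed.

Lemma congB0 (p : nat) (R : comNzRingType) n (a b : R) :
  cong p n a b <-> cong p n (a - b) 0.
Proof.
split=> -[c Ec]; exists c; first by rewrite Ec add0r addrAC subrr add0r.
by apply/eqP; rewrite addrC -subr_eq Ec add0r.
Qed.

(** The quotient of X^((n+1)!) - 1 by X^(n!) - 1, see [trace_polyM]. *)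
Definition trace_poly (R : nzRingType) n : {poly R} := \sum_(i < n.+1) 'X^(n`!) ^+ i.

Lemma trace_polyM (R : comNzRingType) n :
  trace_poly R n * ('X^(n`!) - 1) = 'X^((n.+1)`!) - 1.
Proof. by rewrite factS mulnC exprM [RHS]subrX1 mulrC. Qed.

Lemma trace_poly_map (R S : nzRingType) (f : {rmorphism R -> S}) n :
  map_poly f (trace_poly R n) = trace_poly S n.
Proof. by rewrite rmorph_sum; apply: eq_bigr => i _; rewrite rmorphXn /= map_polyXn. Qed.

Lemma trace_poly_coef0 (R : comNzRingType) n : (trace_poly R n)`_0 = 1.
Proof.
rewrite /trace_poly big_ord_recl coefD coef1 coef_sum big1 ?addr0 // => i _.
by rewrite -exprM coefXn ltn_eqF // muln_gt0 fact_gt0.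
Qed.

Lemma iter_can (T : Type) (f g : T -> T) i : cancel f g -> cancel (iter i f) (iter i g).
Proof. by move=> fg; elim: i => // i IH x; rewrite iterSr /= fg IH. Qed.

(** On a point fixed by f^N, the power f^(N-1) acts as the inverse of [f]. *)
Lemma iter_fix_can (T : Type) (f g : T -> T) N i x : cancel f g -> (0 < N)%N ->
  iter N f x = x -> iter (N.-1 * i) f x = iter i g x.
Proof.
move=> fg N0 fx; have fNx : iter (N * i) f x = x.
  by elim: i => [|i IH]; rewrite ?muln0 // mulnS iterD IH.
rewrite -{2}fNx -{2}(prednK N0) mulSn iterD.
by rewrite (iter_can i fg).
Qed.

Section Conjugation.
Variables (p : nat) (p_pr : prime p) (a : nat) (k : finFieldType).
Hypotheses (pk : p \in [pchar k]) (cardk : #|k| = (p ^ a)%N).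
Variables (K : closedFieldType) (iota : {rmorphism k -> K}).
Hypothesis K_alg : forall x : K, algebraicOver iota x.
Let q := (p ^ a)%N.

Lemma card_gt1 : (1 < q)%N.
Proof. by rewrite /q -cardk finNzRing_gt1. Qed.

Lemma pchar_ext : p \in [pchar K].
Proof. by rewrite (fmorph_pchar iota). Qed.

Lemma closed_perfect (y : K) : exists x, x ^+ p = y.
Proof.
have [|x] := closed_rootP ('X^p - y%:P) _.
  by rewrite size_XnsubC ?prime_gt0 // gtn_eqF // ltnS prime_gt0.
by rewrite /root !hornerE subr_eq0 => /eqP <-; exists x.
Qed.

Lemma fin_perfect (y : k) : exists x, x ^+ p = y.
Proof.
by exists (invF (fmorph_inj (pFrobenius_aut pk)) y); rewrite -[LHS]/(pFrobenius_aut pk _) f_invF.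
Qed.

Variable F : {rmorphism K -> K}.
Hypothesis FE : forall x, F x = x ^+ q.

Lemma frob_base c : F (iota c) = iota c.
Proof. by rewrite FE -rmorphXn /q -cardk expf_card. Qed.

(** The iterates F^i x are all roots of one nonzero polynomial over k, so two of them coincide, and
    [F] is injective. *)
Lemma frob_periodic (x : K) : exists2 N, (0 < N)%N & x ^+ (q ^ N) = x.
Proof.
have [P P0 Px] := K_alg x; pose s := mkseq (fun i => iter i F x) (size P).
have rs : all (root (map_poly iota P)) s.
  apply/allP=> _ /mapP[i _ ->]; elim: i => //= i /eqP Pi.
  rewrite -[map_poly iota P](_ : map_poly F (map_poly iota P) = _).
    by rewrite /root horner_map Pi rmorph0.
  by rewrite -map_poly_comp; apply: eq_map_poly => c /=; rewrite frob_base.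
have : ~~ uniq s.
  apply/negP => us.
  have := max_poly_roots _ rs us; rewrite map_poly_eq0 size_map_poly size_mkseq ltnn.
  by move=> /(_ P0).
case/(uniqPn 0) => i [j [ij js]]; rewrite size_mkseq in js.
rewrite !nth_mkseq ?(ltn_trans ij) // -(subnKC (ltnW ij)) iterD.
move=> H; exists (j - i)%N; first by rewrite subn_gt0.
have injF m : injective (iter m F) by elim: m => //= m IH u v /fmorph_inj/IH.
rewrite -(iter_frobE FE); apply/esym/(injF i).
by rewrite -H.
Qed.

Notation R := (witt p_pr k).
Notation W := (witt p_pr K).
Variables (pi piV : {rmorphism W -> W}).
Hypothesis piE : forall x n, pi x n = x n ^+ q.
Hypotheses (piK : cancel pi piV) (piVK : cancel piV pi).

Lemma pi_base (c : R) : pi (witt_map iota c) = witt_map iota c.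
Proof. by apply/funext => n; rewrite piE -FE; apply: frob_base. Qed.

Lemma piV_base (c : R) : piV (witt_map iota c) = witt_map iota c.
Proof. by rewrite -[RHS]piK pi_base. Qed.

Notation A := (poly_act (witt_map iota) pi).
Notation B := (poly_act (witt_map iota) piV).
Notation ann := (ann_by iota F).

Let congP := @witt_congP p p_pr K pchar_ext closed_perfect.

Lemma residue_poly_act c x :
  residue (A c x) = poly_act iota F (map_poly (@residue p p_pr k) c) (residue x).
Proof.
by apply: poly_act_map => // y; rewrite FE; apply: piE.
Qed.

Lemma residue_const (L : comNzRingType) (b : L) : residue (witt_const p_pr b) = b.
Proof. by []. Qed.

(** [witt_const] is not additive, but it sends 0 to 0, which suffices for [map_poly] to act
    coefficientwise. *)
Lemma map_residue_lift (d : {poly k}) :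
  map_poly (@residue p p_pr k) (map_poly (@witt_const p p_pr k) d) = d.
Proof.
have c0 : @witt_const p p_pr k 0 = 0 by apply/funext => -[].
by apply/polyP => i; rewrite !coef_map_id0 ?rmorph0.
Qed.

Lemma map_residue_eq0 (c : {poly R}) :
  map_poly (@residue p p_pr k) c = 0 -> exists d, c = p%:R * d.
Proof.
move=> c0; have /choice[t Et] : forall i, exists d, c`_i = p%:R * d.
  move=> i; apply: (witt_residue0 pk fin_perfect).
  by have := congr1 (fun P : {poly k} => P`_i) c0; rewrite coef_map coef0.
exists (\poly_(i < size c) t i); apply/polyP => i.
rewrite -polyC_natr coefCM coef_poly; case: ltnP => ci; first exact: Et.
by rewrite nth_default // mulr0.
Qed.

(** [ann_by_mul] solves the problem for residues. A lift of that solution leaves an error p z; as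
    g(pi) is surjective on W(K), subtracting some p w removes the error without changing the
    residue. *)
Lemma ann_by_lift (e : W) (f : {poly k}) (g : {poly R}) :
  f != 0 -> (map_poly (@residue p p_pr k) g)`_0 != 0 -> ann (residue e) f ->
  exists2 e', A g e' = e & ann (residue e') (map_poly (@residue p p_pr k) g * f).
Proof.
move=> f0 g0 ef; have [b gb annb] := ann_by_mul card_gt1 FE frob_base f0 g0 ef.
pose x := witt_const p_pr b.
have [z Ez] : exists z, A g x - e = p%:R * z.
  apply: (witt_residue0 pchar_ext closed_perfect).
  by rewrite rmorphB /= residue_poly_act residue_const gb subrr.
have [|w Ew] := witt_surj pchar_ext closed_perfect (u := A g) _ z.
  move=> c; have gn0 : map_poly (@residue p p_pr k) g != 0.
    by apply: contraNneq g0 => ->; rewrite coef0.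
  have [y <-] := poly_act_surj iota card_gt1 FE c gn0.
  by exists (witt_const p_pr y); rewrite residue_poly_act residue_const.
exists (x - p%:R * w).
  by rewrite raddfB /= poly_act_natr Ew -Ez opprB addrC subrK.
have -> // : residue (x - p%:R * w) = b.
by rewrite rmorphB rmorphM rmorph_nat (pcharf0 pchar_ext) mul0r subr0.
Qed.

Lemma ann_by_one : ann 1 ('X^(0`!) - 1).
Proof.
have E h : poly_act iota F h 1 = iota h.[1].
  rewrite horner_coef rmorph_sum; apply: eq_bigr => i _.
  by rewrite (iter_rmorph_nat _ _ 1) expr1n mulr1n !mulr1.
move=> h; rewrite E -polyC1 dvdp_XsubCl; split=> [/eqP|/eqP->]; last exact: rmorph0.
by rewrite fmorph_eq0.
Qed.

(* [e n] generates a normal basis of W(F_(q^n!)) over W(k); as [pi^(n!)] generates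
   the Galois group over W(F_(q^n!)), [trace_poly n] acts as the trace from level n + 1
   to level n. *)
Definition compatible_normal (e : nat -> W) :=
  [/\ forall n, iter (n`!) pi (e n) = e n,
      forall n, A (trace_poly _ n) (e n.+1) = e n
    & forall n, ann (residue (e n)) ('X^(n`!) - 1)].

Lemma compatible_normal_exists : exists e, compatible_normal e.
Proof.
have f0 n : 'X^(n`!) - 1 != 0 :> {poly k}.
  by rewrite -size_poly_gt0 -polyC1 size_XnsubC ?fact_gt0.
(* The step function must be total: where the annihilator condition fails, the value 0 is a
   placeholder. *)
have /choice[s Es] : forall u : nat * W, exists e',
    ann (residue u.2) ('X^((u.1)`!) - 1) ->
    A (trace_poly _ u.1) e' = u.2 /\ ann (residue e') ('X^((u.1.+1)`!) - 1).
  move=> [n e] /=; have [en|] := EM (ann (residue e) ('X^(n`!) - 1)); last by exists 0.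
  have [|e' Ee' ae'] := ann_by_lift (g := trace_poly _ n) (f0 n) _ en.
    by rewrite trace_poly_map trace_poly_coef0 oner_eq0.
  by exists e' => _; split=> //; rewrite trace_poly_map trace_polyM in ae'.
pose e := fix e n : W := if n is m.+1 then s (m, e m) else 1.
have ae n : ann (residue (e n)) ('X^(n`!) - 1).
  elim: n => [|n IH]; first by rewrite rmorph1; exact: ann_by_one.
  by have [] := Es (n, e n) IH.
have ge n : A (trace_poly _ n) (e n.+1) = e n by have [] := Es (n, e n) (ae n).
exists e; split=> // n; apply/eqP; rewrite -subr_eq0 -(poly_act_Xn1 (witt_map iota)).
(* X^((n+1)!) - 1 factors as (X^(n!) - 1) times the trace polynomial, which carries e_(n+1) to e_n,
   already killed by X^(n!) - 1. *)
apply/eqP; elim: n => [|n IH]; first by rewrite poly_act_Xn1 /= rmorph1 subrr.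
by rewrite -trace_polyM mulrC (poly_actM pi_base) ge.
Qed.

(** * Approximation of W(K) by the elements c(pi) e_n *)

Section Basis.
Variable e : nat -> W.
Hypothesis eP : compatible_normal e.

Lemma e_fixV n : iter (n`!) piV (e n) = e n.
Proof. by have [fe _ _] := eP; rewrite -{1}(fe n) iter_can. Qed.

(** Induction on [m]: modulo p, X^(n!) - 1 divides [c]. Subtracting a lifted multiple of it, which
    kills [e n], leaves p c', and one factor p cancels. *)
Lemma cong_poly_act_ann m c n : cong p m (A c (e n)) 0 ->
  exists d c', c = d * ('X^(n`!) - 1) + (p ^ m)%:R * c'.
Proof.
have [fe _ ae] := eP.
elim: m c => [|m IH] c ce; first by exists 0, c; rewrite mul0r add0r mul1r.
have /ae/dvdpP[d Ed] : poly_act iota F (map_poly (@residue p p_pr k) c) (residue (e n)) = 0.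
  by rewrite -residue_poly_act; have /congP := ce; apply.
pose d' := map_poly (@witt_const p p_pr k) d.
have [|c' Ec'] := @map_residue_eq0 (c - d' * ('X^(n`!) - 1)).
  by rewrite rmorphB rmorphM /= map_residue_lift rmorphB rmorph1 /= map_polyXn Ed subrr.
have {}Ec' : c = d' * ('X^(n`!) - 1) + p%:R * c' by rewrite -Ec' addrC subrK.
move: ce; rewrite Ec' poly_actDl (poly_actM pi_base) poly_act_Xn1 fe subrr raddf0 add0r poly_act_nat.
rewrite -[X in cong _ _ _ X](mulr0 p%:R).
move/(witt_mulp_cong pchar_ext closed_perfect)/IH=> [d1 [c1 ->]].
by exists (d' + p%:R * d1), c1; rewrite expnS natrM; ring.
Qed.

(** The ideal generated by X^(n!) - 1 and p^m also sends [e n] into p^m W(K) when X acts as pi^-1.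
    Hence c(pi) e_n |-> c(pi^-1) e_n is well defined modulo p^m. *)
Lemma cong_poly_act_transfer m c n : cong p m (A c (e n)) 0 -> cong p m (B c (e n)) 0.
Proof.
case/cong_poly_act_ann => d [c' ->]; exists (B c' (e n)).
rewrite poly_actDl (poly_actM piV_base) poly_act_Xn1 e_fixV subrr raddf0 !add0r.
by rewrite poly_act_nat.
Qed.

Lemma trace_polyV n : B (trace_poly _ n) (e n.+1) = e n.
Proof.
have [fe ge _] := eP.
have actg (phi : {rmorphism W -> W}) (x : W) : poly_act (witt_map iota) phi (trace_poly _ n) x =
    \sum_(i < n.+1) iter i (iter (n`!) phi) x.
  rewrite /trace_poly (big_morph (poly_act _ _ ^~ x) (fun c d => poly_actDl _ _ c d x) (poly_act0l _ _ x)).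
  by apply: eq_bigr => i _; rewrite -exprM poly_act_Xn mulnC iterM.
(* Applying pi^(n!) to the right side, which it fixes, raises its exponents from i to i + 1. After
   reversal the left exponents are -(n - i), and these agree because pi^(n!) has period n + 1 on
   e_(n+1). *)
rewrite actg (reindex_inj rev_ord_inj) /= -[RHS]fe -[in RHS]ge actg.
have it_sum : forall i (G : 'I_n.+1 -> W),
  iter i pi (\sum_j G j) = \sum_j iter i pi (G j).
  by elim=> //= i IH G; rewrite IH rmorph_sum.
rewrite it_sum; apply: eq_bigr => i _; rewrite -iterS.
have gf : cancel (iter (n`!) pi) (iter (n`!) piV) by exact: iter_can.
have fx : iter n.+1 (iter (n`!) pi) (e n.+1) = e n.+1.
  by rewrite -iterM -factS fe.
have E : iter (n.+1 - i.+1) (iter (n`!) pi) (iter i.+1 (iter (n`!) pi) (e n.+1)) = e n.+1.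
  by rewrite -iterD subnK.
by rewrite -[in LHS]E (iter_can _ gf).
Qed.

(** The trace polynomials carry e_(n+1) to e_n for pi and pi^-1 alike, so one multiplier serves
    both. This brings elements of different levels to a common one. *)
Lemma raise_level n n' c : (n <= n')%N ->
  exists2 c', A c' (e n') = A c (e n) & B c' (e n') = B c (e n).
Proof.
have [_ ge _] := eP.
move=> /subnKC<-; elim: (n' - n)%N => [|d [c' EA EB]]; first by exists c; rewrite addn0.
exists (c' * trace_poly _ (n + d)); rewrite addnS (poly_actM pi_base, poly_actM piV_base).
  by rewrite ge.
by rewrite trace_polyV.
Qed.

(** Approximation one power of p at a time: a residue of period N lies in the span of the residue of
    [e N], because N divides N!. *)
Lemma poly_act_dense m x : exists n c, cong p m x (A c (e n)).
Proof.
have [fe _ ae] := eP.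
elim: m x => [|m IH] x; first by exists 0%N, 0, (x - A 0 (e 0%N)); rewrite mul1r addrC subrK.
have [N N0 xN] := frob_periodic (residue x).
have [c Ec] : exists c, poly_act iota F c (residue (e N)) = residue x.
  apply: (ann_by_span card_gt1 FE frob_base (fact_gt0 N) cardk (ae N)).
  have /dvdnP[r ->] : (N %| N`!)%N by rewrite dvdn_fact // N0 leqnn.
  by elim: r => [|r Hr]; rewrite ?expr1 // mulSn expnD exprM xN.
pose c' := map_poly (@witt_const p p_pr k) c.
have [|z Ez] := witt_residue0 pchar_ext closed_perfect (x := x - A c' (e N)).
  by rewrite rmorphB /= residue_poly_act map_residue_lift Ec subrr.
have [n [d Hd]] := IH z.
have [c1 E1 _] := raise_level c' (leq_maxl N n).
have [d1 E2 _] := raise_level d (leq_maxr N n).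
exists (maxn N n), (c1 + p%:R * d1); rewrite poly_actDl poly_act_nat E1 E2.
rewrite -[x](subrK (A c' (e N))) Ez addrC; apply: congD; first exact: cong_refl.
by have := cong_scale 1 Hd; rewrite expn1 add1n.
Qed.

(** The graph of the conjugation. The approximating level and polynomial may vary with [m] without
    any compatibility. *)
Definition conjugates x y :=
  forall m, exists n c, cong p m x (A c (e n)) /\ cong p m y (B c (e n)).

Lemma conjugatesD x y x' y' :
  conjugates x y -> conjugates x' y' -> conjugates (x + x') (y + y').
Proof.
move=> xy xy' m; have [n [c [xc yc]]] := xy m; have [n' [c' [xc' yc']]] := xy' m.
have [d Ad Bd] := raise_level c (leq_maxl n n').
have [d' Ad' Bd'] := raise_level c' (leq_maxr n n').
exists (maxn n n'), (d + d'); rewrite !poly_actDl Ad Bd Ad' Bd'.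
by split; apply: congD.
Qed.

Lemma conjugatesZ b x y :
  conjugates x y -> conjugates (witt_map iota b * x) (witt_map iota b * y).
Proof.
move=> xy m; have [n [c [xc yc]]] := xy m; exists n, (b%:P * c); rewrite !poly_act_CM.
by split; apply: congM => //; apply: cong_refl.
Qed.

Lemma conjugates_pi x y : conjugates x y -> conjugates (pi x) (piV y).
Proof.
move=> xy m; have [n [c [xc yc]]] := xy m; exists n, ('X^1 * c).
rewrite (poly_actM pi_base) (poly_actM piV_base) !poly_act_Xn /=.
by split; [exact: (cong_rmorph pi xc) | exact: (cong_rmorph piV yc)].
Qed.

(** On [e n], X^(n! - 1) acts as the inverse of X for both pi and pi^-1, so substituting it in [c]
    exchanges the two values. This makes the conjugation an involution. *)
Lemma conjugates_sym x y : conjugates x y -> conjugates y x.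
Proof.
have [fe _ _] := eP.
move=> xy m; have [n [c [xc yc]]] := xy m; exists n, (c \Po 'X^(n`!.-1)).
have -> : A (c \Po 'X^(n`!.-1)) (e n) = B c (e n).
  rewrite poly_act_comp_Xn; apply: eq_bigr => i _.
  by rewrite (iter_fix_can _ piK) ?fact_gt0.
have -> : B (c \Po 'X^(n`!.-1)) (e n) = A c (e n); last exact: (conj yc xc).
rewrite poly_act_comp_Xn; apply: eq_bigr => i _.
by rewrite (iter_fix_can _ piVK) ?fact_gt0 ?e_fixV.
Qed.

Lemma conjugates0 y : conjugates 0 y -> y = 0.
Proof.
move=> y0; apply: (witt_cong_eq pchar_ext closed_perfect) => m.
have [n [c [/cong_sym/cong_poly_act_transfer xc yc]]] := y0 m.
exact: cong_trans yc xc.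
Qed.

Lemma conjugates_uniq x y y' : conjugates x y -> conjugates x y' -> y = y'.
Proof.
move=> xy /(conjugatesZ (-1)); rewrite rmorphN1 !mulN1r => /(conjugatesD xy).
by rewrite subrr => /conjugates0/subr0_eq.
Qed.

(** Successive approximations of [x], raised to a common level, differ by 0 modulo p^m. By transfer
    so do their conjugates, which converge by completeness. *)
Lemma conjugates_exists x : exists y, conjugates x y.
Proof.
have /choice[u Eu] : forall m, exists u : nat * {poly R}, cong p m x (A u.2 (e u.1)).
  by move=> m; have [n [c xc]] := poly_act_dense m x; exists (n, c).
have [m|y Ey] := witt_complete pchar_ext closed_perfect (u := fun m => B (u m).2 (e (u m).1)).
  have [d Ad Bd] := raise_level (u m).2 (leq_maxl (u m).1 (u m.+1).1).
  have [d' Ad' Bd'] := raise_level (u m.+1).2 (leq_maxr (u m).1 (u m.+1).1).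
  rewrite -Bd -Bd'; apply/congB0; rewrite -poly_actBl; apply: cong_poly_act_transfer.
  rewrite poly_actBl Ad Ad'; apply: (congB0 _ _ _ _).1; apply: (cong_trans _ (Eu m)).
  apply/cong_sym/congP => i im; have /congP := Eu m.+1.
  by apply; apply: ltnW.
by exists y => m; exists (u m).1, (u m).2.
Qed.

End Basis.

Lemma conjugation_exists : exists tau : W -> W,
  [/\ witt_linear iota tau, involutive tau & forall x, tau (pi x) = piV (tau x)].
Proof.
have [e eP] := compatible_normal_exists.
have /choice[tau tauP] := conjugates_exists eP.
have tauE x y : conjugates e x y -> tau x = y.
  by move=> xy; apply: (conjugates_uniq eP) xy.
exists tau; split=> [|x|x]; first split=> [x y|c x].
- by apply: tauE; apply: conjugatesD.
- by apply: tauE; apply: conjugatesZ.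
- by apply: tauE; apply: conjugates_sym.
- by apply: tauE; apply: conjugates_pi.
Qed.

End Conjugation.

(** * Finite subextensions *)

Lemma frobenius_exp_exists (p : nat) (K : comNzRingType) a : p \in [pchar K] ->
  exists F : {rmorphism K -> K}, forall x, F x = x ^+ (p ^ a).
Proof.
move=> pK; elim: a => [|a [F FE]]; first by exists idfun.
exists (F \o pFrobenius_aut pK) => x.
by rewrite /= FE pFrobenius_autE -exprM expnS.
Qed.

(** The group is cyclic, generated by x |-> x^|E| with |E| = |k|^(dim E). *)
Lemma galois_frobenius (k : finFieldType) (L : fieldExtType k) (E : {subfield L})
    (g : gal_of {: finvect_type L}) : g \in 'Gal({: finvect_type L} / E)%g ->
  exists i, forall x : L, g x = x ^+ (#|k| ^ i).
Proof.
move=> gE; have [h hgen Dh] := finField_galois_generator (subvf (E : {vspace finvect_type L})).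
move: gE; rewrite (eqP hgen) => /cycleP[i ->].
exists (\dim E * i)%N => x.
elim: i => [|i IH]; first by rewrite muln0 expr1 expg0 gal_id.
rewrite expgSr galM ?memvf // IH Dh ?memvf //.
by rewrite -exprM -expnD mulnS addnC.
Qed.

Lemma card_finvect (k : finFieldType) (E : vectType k) :
  #|finvect_type E| = (#|k| ^ \dim {: E})%N.
Proof.
rewrite -[RHS](card_vspace {: finvect_type E}).
by apply/esym/eq_card => x; rewrite memvf.
Qed.

Lemma finext_expf (k : finFieldType) (E : fieldExtType k) (x : E) :
  x ^+ (#|k| ^ \dim {: E}) = x.
Proof.
by rewrite -card_finvect; apply: (@expf_card (finvect_type E)).
Qed.

(** The image of [j] already supplies as many roots of X^N - X, with N = |E|, as its degree
    allows. *)
Lemma finext_image (k : finFieldType) (E : fieldExtType k) (K : fieldType)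
    (j : {rmorphism E -> K}) (b : K) :
  b ^+ (#|k| ^ \dim {: E}) = b -> exists x, j x = b.
Proof.
move=> bq; pose fj : finvect_type E -> K := j; pose s := map fj (enum (finvect_type E)).
suff : b \in s by case/mapP=> x _ ->; exists x.
apply: contraT => bs; set N := (#|k| ^ _)%N in bq.
have N1 : (1 < N)%N.
  by rewrite -(expn0 #|k|) ltn_exp2l ?finNzRing_gt1 // adim_gt0.
have sL : size ('X^N - 'X : {poly K}) = N.+1.
  by rewrite size_polyDl ?size_polyXn // size_polyN size_polyX.
have rt (y : K) : y ^+ N = y -> root ('X^N - 'X) y.
  by move=> yN; rewrite /root hornerD hornerN hornerXn hornerX yN subrr.
have : (size (b :: s) < size ('X^N - 'X : {poly K})%R)%N.
  apply: max_poly_roots; rewrite -?size_poly_gt0 ?sL //= ?bs.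
    rewrite rt //=; apply/allP=> _ /mapP[x _ ->]; apply: rt.
    by rewrite -rmorphXn finext_expf.
  by rewrite (map_inj_uniq (fmorph_inj j : injective fj)) enum_uniq.
by rewrite sL /= size_map -cardE card_finvect ltnn.
Qed.

Theorem propositionH1 (p : nat) (p_pr : prime p) (a : nat)
    (k : finFieldType) (charkp : p \in [pchar k]) (cardk : #|k| = (p ^ a)%N)
    (kbar : closedFieldType) (iota : {rmorphism k -> kbar})
    (kbar_alg : forall x : kbar, algebraicOver iota x)
    (pi : {rmorphism witt p_pr kbar -> witt p_pr kbar})
    (pi_inv : witt p_pr kbar -> witt p_pr kbar)
    (pi_lift : lifts_frobenius (p ^ a) pi)
    (piK : cancel pi pi_inv) (pi_invK : cancel pi_inv pi) :
  exists tau : witt p_pr kbar -> witt p_pr kbar,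
    padic_continuous p tau /\
    witt_linear iota tau /\
    (forall x, tau (tau x) = x) /\
    (forall x, tau (pi x) = pi_inv (tau x)) /\
    (forall (E : fieldExtType k) (j : {rmorphism E -> kbar}),
       over_base iota j ->
       forall x : witt p_pr E, exists y : witt p_pr E,
         tau (witt_map j x) = witt_map j y) /\
    (forall (L : fieldExtType k) (j : {rmorphism L -> kbar}) (E : {subfield L}),
       over_base iota j ->
       forall (tauL : witt p_pr L -> witt p_pr L)
              (tauE : witt p_pr (subvs_of E) -> witt p_pr (subvs_of E)),
         restricts_to j tau tauL ->
         restricts_to (j \o vsval) tau tauE ->
         (forall x : witt p_pr L,
            witt_trace E (tauL x) = tauE (witt_trace E x)) /\
         (forall y : witt p_pr (subvs_of E),
            tauL (witt_map vsval y) = witt_map vsval (tauE y))).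
Proof.
have pK := pchar_ext charkp iota; have K_perf := closed_perfect p_pr (K := kbar).
have [F FE] := frobenius_exp_exists a pK.
(* Only the residue of [pi] is prescribed, but two ring morphisms that agree modulo p agree modulo
   every p^m; hence [pi] is the componentwise Frobenius. *)
have piE x n : pi x n = x n ^+ (p ^ a).
  have -> : pi x = witt_map F x; last exact: FE.
  apply: (witt_cong_eq pK K_perf) => m.
  apply: (witt_rmorph_cong pK K_perf (g := witt_map F)) => {}x.
  by apply/(witt_congP pK K_perf) => -[|//] _; rewrite pi_lift -FE.
pose piZ := GRing.isZmodMorphism.Build _ _ pi_inv (can2_zmod_morphism piK pi_invK).
pose piR := GRing.isMonoidMorphism.Build _ _ pi_inv (can2_monoid_morphism piK pi_invK).
pose piV : {rmorphism witt p_pr kbar -> witt p_pr kbar} := HB.pack pi_inv piZ piR.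
have [tau [tau_lin tauK tau_pi]] :=
  @conjugation_exists p p_pr a k charkp cardk kbar iota kbar_alg F FE pi piV piE piK pi_invK.
have [tauD tauM] := tau_lin.
have iterE i x n : iter i pi x n = x n ^+ (#|k| ^ i).
  by elim: i => [|i IH] /=; rewrite ?expr1 // piE IH -exprM expnSr cardk.
have tau_iter i x : tau (iter i pi x) = iter i pi_inv (tau x).
  by elim: i => //= i IH; rewrite tau_pi IH.
have inj_map (M : fieldType) (j : {rmorphism M -> kbar}) :
    injective (@witt_map p p_pr M kbar j).
  move=> x y xy; apply/funext => n; apply: (fmorph_inj j).
  exact: (congr1 (fun z : witt p_pr kbar => z n) xy).
exists tau; split.
  (* The factor p^n is the image of a scalar of W(k), so linearity takes it out of [tau]. *)
  move=> x n; exists n => _ [c ->]; exists (tau c).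
  by rewrite tauD -(rmorph_nat (witt_map iota)) tauM.
do 3![split=> //]; split.
  move=> E j _ x.
  (* W(E) consists of the fixed points of pi^(dim E), and [tau] maps them to fixed points of the
     inverse power, which are the same. *)
  have xf : iter (\dim {: E}) pi (witt_map j x) = witt_map j x.
    by apply/funext => n; rewrite iterE /witt_map -rmorphXn finext_expf.
  have tf : iter (\dim {: E}) pi (tau (witt_map j x)) = tau (witt_map j x).
    by rewrite -{1}xf tau_iter iter_can.
  have /choice[y Ey] : forall n, exists b, j b = tau (witt_map j x) n.
    by move=> n; apply: finext_image; rewrite -iterE tf.
  by exists y; apply/funext => n; rewrite /witt_map Ey.
move=> L j E _ tauL tauE rL rE; split=> [x|y]; last first.
  by apply: (inj_map _ j); rewrite -rL; exact: rE.
apply: (inj_map _ (j \o vsval)).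
rewrite -rE.
have trE (z : witt p_pr L) : witt_map (j \o vsval) (witt_trace E z) =
    \sum_(g in 'Gal({: finvect_type L} / E)%g) witt_map j (witt_map (g : L -> L) z).
  rewrite -[LHS]/(witt_map j (witt_map vsval (witt_trace E z))) witt_traceE.
  by rewrite /gal_sum rmorph_sum.
have tau0 : tau 0 = 0 by apply: (addrI (tau 0)); rewrite -tauD !addr0.
(* Each [g] acts as a power pi^i, which [tau] turns into pi^-i; reindexing by inversion therefore
   matches the two sums term by term. *)
rewrite !trE (big_morph tau tauD tau0) (reindex_inj invg_inj) /=.
apply: eq_big => [g|g]; first by rewrite groupV.
rewrite groupV => gG; have [i gi] := galois_frobenius gG.
have gE z : witt_map j (witt_map (g : L -> L) z) = iter i pi (witt_map j z).
  by apply/funext => n; rewrite iterE /witt_map gi rmorphXn.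
(* Applying pi^i to both sides turns pi^-i into the identity on the right and composes [g] with its
   inverse on the left. *)
rewrite gE tau_iter rL; apply: (can_inj (iter_can i piK)).
rewrite (iter_can i pi_invK) -gE.
congr (witt_map j _); apply/funext => n; rewrite /witt_map.
by rewrite -galM ?memvf // mulVg gal_id.
Qed.
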